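(* Let $B\in\mathbb Z_{\ge1}$, $\mu\prec B$, $\alpha\in(0,1)$, $c>0$, $K>0$. Suppose $r=r(t)$ satisfies $\log(r)=o(t^{\alpha/2})$ as $t\to\infty$ and $r(t)\ge r_0$ for all $t$ for some fixed $r_0>1$, and suppose $|\nu(x)-cx^{-\alpha}|\le Kx^{-\alpha/2}$ for all $x\in(0,1)$. Let $\hat S_{t,T}=S_t\big((1+r)^{\phi_1/S_t}-1\big)$. Then for every $\epsilon>0$ there exists a constant $C=C(\epsilon,\alpha,c,K,r_0)$ such that $$\limsup_{t\to\infty}P\left(\ell_\alpha(S_{t,T},\hat S_{t,T})>\frac{CB\log(r)^2}{t^\alpha}\right)<\epsilon,\qquad\text{where}\quad \ell_\alpha(S_{t,T},\hat S_{t,T}):=\frac{|S_{t,T}-\hat S_{t,T}|^2}{(rt)^{2\alpha}}.$$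
   Context: Setting (Poissonized generalized unseen species problem). $\mathcal{S}$ is an at most countable set of species and $\mu$ is a probability measure on $2^{\mathcal S}$ supported on finite sets; $\mu\prec B$ means $\mu(A)=0$ whenever $|A|>B$. $t,t'>0$, $r=t'/t$, $T=t+t'=(1+r)t$. Let $X_1,X_2,\dots$ be i.i.d. from $\mu$, and let $n\sim\mathrm{Poisson}(t)$, $m\sim\mathrm{Poisson}(t')$ be independent of each other and of the $X_i$. The first expedition observes $X_1,\dots,X_n$, the second $X_{n+1},\dots,X_{n+m}$. For $s\in\mathcal S$, $N_s$ (resp. $N_s'$) is the number of sets observed in the first (resp. second) expedition that contain $s$. $S_t=|\{s:N_s>0\}|$, $S_T=|\{s:N_s+N_s'>0\}|$, $S_{t,T}=S_T-S_t$, $\phi_1=|\{s:N_s=1\}|$. For $s\in\mathcal S$, $M_s=\sum_{A\ni s}\mu(A)$, and $\nu(x)=\sum_{s\in\mathcal S}1_{M_s>x}$. $\log(r)^2$ means $(\log r)^2$. When $S_t=0$ the estimator is interpreted as $0$. *)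

(* Defs.v *)
From HB Require Import structures.
From mathcomp Require Export all_boot all_order all_algebra finmap.
From mathcomp Require Export all_classical all_reals all_analysis.

Set Implicit Arguments.
Unset Strict Implicit.
Unset Printing Implicit Defensive.

Export Order.TTheory GRing.Theory Num.Theory.
Export numFieldNormedType.Exports.

Local Open Scope classical_set_scope.
Local Open Scope ring_scope.

(* A probability measure on the subsets of a countable S that is supported on
   the (countably many) finite ones is a probability measure on {fset S},
   taken with its discrete sigma-algebra. *)
HB.instance Definition _ (S : countType) :=
  @isMeasurable.Build default_measure_display {fset S}
    discrete_measurable discrete_measurable0
    discrete_measurableC discrete_measurableU.

(* Lets =o_ infer the filter structure of pinfty_nbhs R. *)
Canonical pinfty_filter_on (R : numFieldType) :=
  FilterType (pinfty_nbhs R) (@proper_pinfty_nbhs R).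

Section Model.
Context (R : realType) (S : countType).
Implicit Type mu : probability {fset S} R.

(* mu \prec B *)
Definition card_bounded mu (B : nat) :=
  forall A : {fset S}, (B < #|` A|)%N -> mu [set A] = 0%E.

(* M_s *)
Definition incidence_prob mu (s : S) : \bar R :=
  \esum_(A in [set A : {fset S} | s \in A]) mu [set A].

(* nu(x); the value is +oo when infinitely many species have M_s > x *)
Definition nu mu (x : R) : \bar R :=
  \esum_(s in [set: S]) ((x%:E < incidence_prob mu s)%E%:R)%:E.

End Model.

Section Independence.
Context d (T : measurableType d) (R : realType) (P : probability T R).

Definition mutual_independence (I : choiceType) (F : I -> set (set T)) :=
  forall (J : {fset I}) (E : I -> set T),
    (forall i, i \in J -> F i (E i)) ->
    P (\bigcap_(i in [set` J]) E i) = (\prod_(i <- J) P (E i))%E.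

Definition sigma_RV d' (T' : measurableType d') (Y : {RV P >-> T'}) :
    set (set T) :=
  preimage_set_system [set: T] Y measurable.

Section Expeditions.
Context (S : countType) (mu : probability {fset S} R) (t t' : R).
Context (X : nat -> {RV P >-> {fset S}}) (n m : {RV P >-> nat}).

(* The observations are indexed from 0. *)
Record poissonized_expeditions : Prop := PoissonizedExpeditions {
  observation_law : forall i (A : set {fset S}), P (X i @^-1` A) = mu A ;
  first_size_law : forall k, P (n @^-1` [set k]) = (poisson_pmf t k)%:E ;
  second_size_law : forall k, P (m @^-1` [set k]) = (poisson_pmf t' k)%:E ;
  expeditions_indep : mutual_independence (fun j : bool + nat =>
    match j with
    | inl false => sigma_RV n
    | inl true => sigma_RV m
    | inr i => sigma_RV (X i)
    end) }.

End Expeditions.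
End Independence.

Section Counts.
Context (S : countType) (X : nat -> {fset S}) (n m : nat).

(* N_s and N'_s *)
Definition first_count (s : S) : nat := (\sum_(0 <= i < n) (s \in X i))%N.
Definition second_count (s : S) : nat := (\sum_(n <= i < n + m) (s \in X i))%N.

(* S_t, S_T and phi_1. The sets below are finite, see finite_first_count and
   finite_total_count, so fset_set does not return its default value. *)
Definition species_first : nat :=
  #|` fset_set [set s | (0 < first_count s)%N]|.
Definition species_total : nat :=
  #|` fset_set [set s | (0 < first_count s + second_count s)%N]|.
Definition singletons_first : nat :=
  #|` fset_set [set s | first_count s = 1%N]|.

Lemma finite_total_count :
  finite_set [set s | (0 < first_count s + second_count s)%N].
Proof.
apply: (@sub_finite_set _ _ (\bigcup_(i in `I_(n + m)) [set` X i])); last first.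
  by apply: bigcup_finite => [|i _]; [exact: finite_II|exact: finite_fset].
move=> s /=; rewrite /first_count /second_count -big_cat_nat ?leq_addr//=.
rewrite lt0n sum_nat_seq_neq0 => /hasP[i].
by rewrite mem_index_iota /= => inm; case sX: (s \in X i) => // _; exists i.
Qed.

End Counts.

Lemma finite_first_count (S : countType) (X : nat -> {fset S}) (n : nat)
    (p : pred nat) : ~~ p 0%N -> finite_set [set s | p (first_count X n s)].
Proof.
move=> p0; apply: sub_finite_set (finite_total_count X n 0) => s /= ps.
by rewrite addn_gt0 lt0n; case: eqP ps p0 => // -> ->.
Qed.

Section Estimation.
Context (R : realType) (S : countType) (X : nat -> {fset S}).

(* S_{t,T} *)
Definition unseen (n m : nat) : R :=
  (species_total X n m)%:R - (species_first X n)%:R.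

(* hat S_{t,T}; it is 0 when S_t = 0, because of the leading factor. *)
Definition unseen_estimator (r : R) (n : nat) : R :=
  (species_first X n)%:R *
    ((1 + r) `^ ((singletons_first X n)%:R / (species_first X n)%:R) - 1).

End Estimation.

(* ell_alpha *)
Definition normalized_loss (R : realType) (alpha r t x y : R) : R :=
  `|x - y| ^+ 2 / (r * t) `^ (2 * alpha).

(* Main.v *)
Require Import Defs.
From mathcomp Require Import measurable_realfun ring lra.

Set Implicit Arguments.
Unset Strict Implicit.
Unset Printing Implicit Defensive.

Local Open Scope classical_set_scope.
Local Open Scope ring_scope.

(** Write [a = tau M_s] for the expected number of sets containing the species
    [s] in a Poisson([tau]) sample. The proof has three independent parts.

    Means.  By Poissonization [P (N_s = 0) = e^-a] and [P (N_s = 1) = a e^-a],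
    so [E S_t = f t] and [E phi_1 = g t] with [f tau = sum_s (1 - e^-a)] and
    [g tau = sum_s a e^-a]; likewise [E S_T = f T], because the two expeditions
    together form one Poisson([T]) sample ([total_sample]).  Both sums are
    integrals of [nu] against an exponential weight, and the power law of [nu]
    turns them into [f tau = c' tau^alpha + O(tau^(alpha/2))] and
    [g tau = alpha c' tau^alpha + O(tau^(alpha/2))] with the same constant
    [c' = c Gamma(1 - alpha)]; the factor [alpha] comes from
    [Gamma(2 - alpha) = (1 - alpha) Gamma(1 - alpha)] ([mean_asymptotics]).

    Fluctuations.  The counts of two species are dependent only through the
    sets that contain both: the covariance of the indicators for [s] and [u] is
    at most [27 k / (1 + a)], where [k = tau M_su] and [M_su] is the mass of
    those sets.  Since a set has at most [B] elements, [sum_u M_su <= B M_s],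
    and [a / (1 + a) <= 1 - e^-a], so the variances are at most [27 B f tau],
    that is [O(B tau^alpha)] ([seen_concentration], [once_concentration]).
    Chebyshev then puts all three statistics within
    [O(sqrt B tau^(alpha/2))] of their leading terms with probability at least
    [1 - eps / 2].

    Plugging in.  On that event [phi_1 / S_t] is
    [alpha + O(sqrt B t^(-alpha/2))].  As [ln r = o(t^(alpha/2))], raising
    [1 + r] to this power costs only a relative error
    [O(sqrt B t^(-alpha/2) ln r)] ([plug_in_error]), and squaring gives the
    bound on the loss ([loss_bound]).  The constant does not involve [B]: only
    the time from which the estimates hold does. *)

(** * Sums over a countable type *)

Section CountableSums.
Context (R : realType) (S : countType).
Local Open Scope ereal_scope.

(** Transports a sum over a countable type to a series indexed by [nat], where
    monotone convergence and scaling are available. *)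
Lemma esum_countable (a : S -> \bar R) : (forall s, 0 <= a s) ->
  \esum_(s in [set: S]) a s = \sum_(i <oo) oapp a 0 (@pickle_inv S i).
Proof.
move=> a0.
have a'0 i : 0 <= oapp a 0 (@pickle_inv S i) by case: (@pickle_inv S i) => /=.
rewrite nneseries_esumT//.
rewrite (esumID (range (@choice.pickle S)))//.
rewrite [X in _ = _ + X]esum1 ?adde0; last first.
  move=> i [_ /= Ni]; case E : (@pickle_inv S i) => [s|]//=.
  by case: Ni; exists s => //; have := @pickle_invK S i; rewrite E.
rewrite setTI esum_image; last by move=> x y _ _; exact: (pcan_inj choice.pickleK).
by apply: eq_esum => s _ /=; rewrite pickleK_inv.
Qed.

Lemma integral_esum d (T : measurableType d) (mu : {measure set T -> \bar R})
    (D : set T) (f : S -> T -> \bar R) : measurable D ->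
  (forall s, measurable_fun D (f s)) -> (forall s x, D x -> 0 <= f s x) ->
  \int[mu]_(x in D) (\esum_(s in [set: S]) f s x) =
  \esum_(s in [set: S]) (\int[mu]_(x in D) f s x).
Proof.
move=> mD mf f0; rewrite esum_countable; last first.
  by move=> s; apply: integral_ge0 => x Dx; exact: f0.
transitivity (\int[mu]_(x in D) (\sum_(i <oo)
    (oapp f (cst 0) (@pickle_inv S i)) x)).
  apply: eq_integral => x /set_mem Dx; rewrite esum_countable => [|s]; last first.
    exact: f0.
  by apply: eq_eseriesr => i _; case: (@pickle_inv S i).
rewrite integral_nneseries//.
- apply: eq_eseriesr => i _; case: (@pickle_inv S i) => //=.
  by rewrite integral0.
- by move=> i; case: (@pickle_inv S i) => //=.
- by move=> i x Dx; case: (@pickle_inv S i) => //= s; exact: f0.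
Qed.

Lemma measurable_esum d (T : measurableType d) (D : set T)
    (f : S -> T -> \bar R) : measurable D ->
  (forall s, measurable_fun D (f s)) -> (forall s x, 0 <= f s x) ->
  measurable_fun D (fun x => \esum_(s in [set: S]) f s x).
Proof.
move=> mD mf f0.
apply: (eq_measurable_fun (fun x => \sum_(i <oo)
    (oapp f (cst 0) (@pickle_inv S i)) x)).
  move=> x _; rewrite esum_countable => [|s]; last exact: f0.
  by apply: eq_eseriesr => i _; case: (@pickle_inv S i).
apply: ge0_emeasurable_sum => //= i; last first.
  by move=> _; case: (@pickle_inv S i).
by move=> x _ _; case: (@pickle_inv S i) => //=.
Qed.

Lemma esumZl (a : S -> \bar R) (k : R) : (0 <= k)%R -> (forall s, 0 <= a s) ->
  \esum_(s in [set: S]) (k%:E * a s) = k%:E * \esum_(s in [set: S]) a s.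
Proof.
move=> k0 a0; rewrite !esum_countable//; last by move=> s; rewrite mule_ge0.
rewrite -nneseriesZl//; last by move=> i _; case: (@pickle_inv S i).
by apply: eq_eseriesr => i _; case: (@pickle_inv S i) => //=; rewrite mule0.
Qed.

Lemma esum_indic (D : set S) : finite_set D ->
  \esum_(s in [set: S]) (\1_D s)%:E = (#|` fset_set D|%:R)%:E :> \bar R.
Proof.
move=> fD.
transitivity (\esum_(s in D) (1%:E : \bar R)).
  by rewrite [RHS]esum_mkcond; apply: eq_esum => s _; rewrite indicE; case: ifP.
rewrite esum_fset// fsbig_finite//= sumEFin big_const_seq count_predT.
by rewrite iter_addr_0.
Qed.

End CountableSums.

Section Atoms.
Context (R : realType) d (T : measurableType d).
Local Open Scope ereal_scope.

Lemma measure_partition_nat (mu : {measure set T -> \bar R}) (L : T -> nat)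
    (D : set T) : (forall k, measurable (D `&` L @^-1` [set k])) ->
  mu D = \sum_(k <oo) mu (D `&` L @^-1` [set k]).
Proof.
move=> mD.
rewrite [in LHS](_ : D = \bigcup_k (D `&` L @^-1` [set k])); last first.
  by apply/seteqP; split=> [x Dx|x [k _ []]//]; exists (L x).
rewrite measure_bigcup//=; last first.
  by move=> i j _ _ [x [[_ /= <-] [_ /= <-]]].
by apply: eq_eseriesl => k; rewrite in_setT.
Qed.

End Atoms.

Lemma measure_atoms (R : realType) (S : countType)
    (mu : {measure set {fset S} -> \bar R}) (E : set {fset S}) :
  (mu E = \esum_(A in E) mu [set A])%E.
Proof.
rewrite (@measure_partition_nat _ _ _ mu (@choice.pickle {fset S}))//.
rewrite esum_mkcond esum_countable; last by move=> A; case: ifP.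
apply: eq_eseriesr => k _.
case Ek : (pickle_inv k) => [A|] /=; last first.
  rewrite (_ : _ `&` _ = set0) ?measure0//; apply/seteqP; split=> // A [_ /=].
  by move=> Ak; rewrite -Ak pickleK_inv in Ek.
have kA : choice.pickle A = k by have := @pickle_invK {fset S} k; rewrite Ek.
have -> : @choice.pickle {fset S} @^-1` [set k] = [set A].
  apply/seteqP; split=> [A' /= |A' /= -> //]; rewrite -kA.
  exact: (pcan_inj choice.pickleK).
case: ifPn => [/set_mem EA|/negP EA].
  by congr (mu _); apply/seteqP; split=> [x []//|x /= ->].
rewrite (_ : _ `&` _ = set0) ?measure0//; apply/seteqP; split=> // x [Ex /= xA].
by apply: EA; rewrite inE -xA.
Qed.

(** * Concentration of a count from pairwise overlaps *)

Section SecondMoment.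
Context (R : realType) (S : countType) d (T : measurableType d).
Context (P : probability T R).
Local Open Scope ereal_scope.

(** Chebyshev for the number [Z] of events [E s] that occur, when the excess
    [k s u] of the probability of [E s `&` E u] over that of independent events
    is summable.  The variance is never formed as a difference: integrating
    [(Z - m)^2 + 2 m Z = Z^2 + m^2] keeps every term nonnegative, so no
    integrability has to be known beforehand. *)
Lemma second_moment_concentration (E : S -> set T) (Z : T -> R)
    (k : S -> S -> \bar R) (m V l : R) :
  (forall s, measurable (E s)) ->
  (forall w, (Z w)%:E = \esum_(s in [set: S]) (\1_(E s) w)%:E) ->
  \esum_(s in [set: S]) P (E s) = m%:E ->
  (forall s u, 0 <= k s u) ->
  (forall s u, P (E s `&` E u) <= P (E s) * P (E u) + k s u) ->
  \esum_(s in [set: S]) \esum_(u in [set: S]) k s u <= V%:E ->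
  (0 < l)%R ->
  P [set w | (l <= `|Z w - m|)%R] <= (V / l ^+ 2)%:E.
Proof.
move=> mE ZE Em k0 kE kV l0.
have mI s : measurable_fun [set: T] (fun w => (\1_(E s) w)%:E : \bar R).
  by apply/measurable_EFinP; exact: measurable_indic.
have I0 s w : 0 <= (\1_(E s) w)%:E :> \bar R by rewrite lee_fin.
have Z0 w : (0 <= Z w)%R by rewrite -lee_fin ZE esum_ge0.
have m0 : (0 <= m)%R by rewrite -lee_fin -Em esum_ge0.
have mZ : measurable_fun [set: T] Z.
  apply/measurable_EFinP; rewrite [X in measurable_fun _ X](_ : _ = fun w =>
    \esum_(s in [set: S]) (\1_(E s) w)%:E); last exact/funext.
  exact: measurable_esum.
have intZ : \int[P]_w (Z w)%:E = m%:E.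
  under eq_integral do rewrite ZE.
  rewrite integral_esum// -Em; apply: eq_esum => s _.
  by rewrite integral_indic// setIT.
have intZE s : \int[P]_w ((\1_(E s) w)%:E * (Z w)%:E) =
    \esum_(u in [set: S]) P (E s `&` E u).
  transitivity (\int[P]_w (\esum_(u in [set: S])
      ((\1_(E s) w)%:E * (\1_(E u) w)%:E))).
    by apply: eq_integral => w _; rewrite ZE esumZl.
  rewrite integral_esum//; last first.
    by move=> u; apply: emeasurable_funM.
  apply: eq_esum => u _; rewrite -[E s `&` E u]setIT -integral_indic//; last first.
    exact: measurableI.
  by apply: eq_integral => w _; rewrite indicI.
have intZ2 : \int[P]_w (Z w ^+ 2)%:E <= (m ^+ 2 + V)%:E.
  rewrite [leLHS](_ : _ = \esum_(s in [set: S])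
      \esum_(u in [set: S]) P (E s `&` E u)); last first.
    transitivity (\int[P]_w (\esum_(s in [set: S])
        ((\1_(E s) w)%:E * (Z w)%:E))).
      apply: eq_integral => w _; rewrite expr2 EFinM {1}ZE muleC -esumZl//.
      by apply: eq_esum => s _; rewrite muleC.
    rewrite integral_esum//; last 2 first.
    - by move=> s; apply: emeasurable_funM => //; exact/measurable_EFinP.
    - by move=> s w _; apply: mule_ge0; rewrite // lee_fin.
    exact: eq_esum.
  apply: (@le_trans _ _ (\esum_(s in [set: S]) \esum_(u in [set: S])
      (P (E s) * P (E u) + k s u))).
    by apply: le_esum => s _; apply: le_esum => u _; exact: kE.
  rewrite [leLHS](_ : _ = \esum_(s in [set: S]) (m%:E * P (E s)) +
     \esum_(s in [set: S]) \esum_(u in [set: S]) k s u); last first.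
    rewrite -esumD//; last 2 first.
    - by move=> s _; rewrite mule_ge0.
    - by move=> s _; exact: esum_ge0.
    apply: eq_esum => s _; rewrite esumD//; last by move=> u _; rewrite mule_ge0.
    congr (_ + _).
    have -> : P (E s) = (fine (P (E s)))%:E by rewrite fineK// fin_num_measure.
    by rewrite esumZl// ?fine_ge0// Em muleC.
  by rewrite esumZl// Em -EFinM -expr2 EFinD leeD2l.
have mZm : measurable_fun [set: T] (fun w => (Z w - m) ^+ 2)%R.
  by apply: measurable_funX; exact: measurable_funB.
have key : \int[P]_w ((Z w - m) ^+ 2)%:E <= V%:E.
  have : \int[P]_w ((Z w - m) ^+ 2)%:E + ((2 * m) * m)%:E
       = \int[P]_w (Z w ^+ 2)%:E + (m ^+ 2)%:E.
    have Pm : \int[P]_w (m ^+ 2)%:E = (m ^+ 2)%:E.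
      by rewrite integral_cst//= [X in _ * X]probability_setT mule1.
    rewrite -[in RHS]Pm EFinM -intZ -ge0_integralZl_EFin//; last 3 first.
    - by move=> w _; rewrite lee_fin.
    - exact/measurable_EFinP.
    - by rewrite mulr_ge0.
    rewrite -!ge0_integralD//.
    + by apply: eq_integral => w _; rewrite -EFinM -!EFinD; congr EFin; ring.
    + by move=> w _; rewrite lee_fin sqr_ge0.
    + by apply/measurable_EFinP/measurable_funX.
    + by move=> w _; rewrite lee_fin sqr_ge0.
    + by move=> w _; rewrite lee_fin sqr_ge0.
    + exact/measurable_EFinP.
    + by move=> w _; rewrite -EFinM lee_fin !mulr_ge0.
    + by apply/measurable_EFinP/measurable_funM => //; exact/measurable_funM.
  move=> e; rewrite -(leeD2rE _ _ (isT : ((2 * m) * m)%:E \is a fin_num)) e.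
  apply: (le_trans (leeD2r _ intZ2)).
  by rewrite -!EFinD lee_fin; nra.
have mA : measurable [set w | (l <= `|Z w - m|)%R].
  rewrite -[X in measurable X]setTI; apply: measurable_fun_le => //.
  by apply: measurableT_comp => //; exact: measurable_funB.
rewrite EFinM lee_pdivlMr ?exprn_gt0// muleC; apply: le_trans key.
rewrite -[X in _ * P X]setIT -integral_indic// -ge0_integralZl_EFin//; last 2 first.
- by apply/measurable_EFinP; exact: measurable_indic.
- by rewrite sqr_ge0.

apply: ge0_le_integral => //.
- by move=> w _; rewrite -EFinM lee_fin mulr_ge0// sqr_ge0.
- by apply: emeasurable_funM => //; apply/measurable_EFinP; exact: measurable_indic.
- exact/measurable_EFinP.
- move=> w _; rewrite -EFinM lee_fin indicE; case: (w \in _) / boolP.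
  + rewrite inE /= => lZ; rewrite mulr1 -(real_normK (num_real (Z w - m))).
    by rewrite lerXn2r// nnegrE ltW.
  + by rewrite mulr0 sqr_ge0.
Qed.

End SecondMoment.

(** * Poisson series *)

Section PoissonSeries.
Context (R : realType).
Local Open Scope ereal_scope.

Lemma expR_nneseries (x : R) : (0 <= x)%R ->
  \sum_(k <oo) (x ^+ k / k`!%:R)%:E = (expR x)%:E.
Proof.
move=> x0; rewrite /expR -EFin_lim; last exact: is_cvg_series_exp_coeff.
by apply/congr_lim/funext => n/=; rewrite /series/= -sumEFin.
Qed.

Lemma nneseries_shift (f : nat -> \bar R) : (forall k, 0 <= f k) ->
  f 0%N = 0 -> \sum_(k <oo) f k = \sum_(k <oo) f k.+1.
Proof.
move=> f0 f00; rewrite nneseries_recl// f00 add0e -(nneseries_addn 1)//.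
by apply: eq_eseriesr => k _; rewrite addn1.
Qed.

Lemma poisson_pgf (t q : R) : (0 < t)%R -> (0 <= q)%R ->
  \sum_(k <oo) (poisson_pmf t k * q ^+ k)%:E = (expR (- (t * (1 - q))))%:E.
Proof.
move=> t0 q0.
transitivity (\sum_(k <oo) ((expR (- t))%:E * ((t * q) ^+ k / k`!%:R)%:E)).
  apply: eq_eseriesr => k _; rewrite -EFinM /poisson_pmf t0 exprMn.
  by congr EFin; ring.
have tq0 : (0 <= t * q)%R by rewrite mulr_ge0// ltW.
rewrite nneseriesZl => [|k _]; last by rewrite lee_fin divr_ge0// exprn_ge0.
by rewrite expR_nneseries// -EFinM -expRD; congr (expR _)%:E; ring.
Qed.

Lemma poisson_pmfS (t : R) k : (0 < t)%R ->
  (poisson_pmf t k.+1 * k.+1%:R = t * poisson_pmf t k)%R.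
Proof.
move=> t0; rewrite /poisson_pmf t0 factS natrM exprS.
have k1 : (k.+1%:R != 0 :> R)%R by rewrite pnatr_eq0.
have kf : (k`!%:R != 0 :> R)%R by rewrite pnatr_eq0 -lt0n fact_gt0.
move: (k.+1%:R) (k`!%:R) k1 kf => x y x0 y0.
by field; rewrite x0 y0.
Qed.

Lemma poisson_pgf_deriv1 (t q : R) : (0 < t)%R -> (0 <= q)%R ->
  \sum_(k <oo) (poisson_pmf t k * (k%:R * q ^+ k.-1))%:E
    = (t * expR (- (t * (1 - q))))%:E.
Proof.
move=> t0 q0; rewrite nneseries_shift/=; last 2 first.
- by move=> k; rewrite lee_fin !mulr_ge0 ?poisson_pmf_ge0 ?exprn_ge0.
- by rewrite mul0r mulr0.
rewrite EFinM -poisson_pgf// -nneseriesZl; last first.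
  by move=> k _; rewrite lee_fin mulr_ge0 ?poisson_pmf_ge0 ?exprn_ge0.
by apply: eq_eseriesr => k _; rewrite -EFinM !mulrA poisson_pmfS.
Qed.

Lemma poisson_pgf_deriv2 (t q : R) : (0 < t)%R -> (0 <= q)%R ->
  \sum_(k <oo) (poisson_pmf t k * ((k * k.-1)%:R * q ^+ k.-2))%:E
    = (t ^+ 2 * expR (- (t * (1 - q))))%:E.
Proof.
move=> t0 q0; rewrite nneseries_shift/=; last 2 first.
- by move=> k; rewrite lee_fin !mulr_ge0 ?poisson_pmf_ge0 ?exprn_ge0.
- by rewrite mul0n mul0r mulr0.
rewrite expr2 -mulrA EFinM -poisson_pgf_deriv1// -nneseriesZl; last first.
  by move=> k _; rewrite lee_fin !mulr_ge0 ?poisson_pmf_ge0 ?exprn_ge0.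
apply: eq_eseriesr => k _; rewrite -EFinM natrM.
by rewrite !mulrA poisson_pmfS.
Qed.

Lemma poisson_pmf_convolution (t t' : R) k : (0 < t)%R -> (0 < t')%R ->
  (\sum_(a < k.+1) poisson_pmf t a * poisson_pmf t' (k - a) =
   poisson_pmf (t + t') k)%R.
Proof.
move=> t0 t'0; rewrite /poisson_pmf addr_gt0// t0 t'0 opprD expRD.
rewrite [(t + t')%R]addrC exprDn.
rewrite !mulr_suml; apply: eq_bigr => -[a /= ak] _.
rewrite ltnS in ak; rewrite -(mulr_natr _ 'C(k, a)).
have fn j : (j`!%:R != 0 :> R)%R by rewrite pnatr_eq0 -lt0n fact_gt0.
have -> : ('C(k, a)%:R = k`!%:R / (a`!%:R * (k - a)`!%:R) :> R)%R.
  by apply/(canRL (mulfK _)); rewrite ?mulf_neq0// -!natrM bin_fact.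
by field; rewrite !fn.
Qed.

End PoissonSeries.

Lemma measure_partition_fin d (T : measurableType d) (R : realType)
    (mu : {measure set T -> \bar R}) (I : finType) (F : I -> set T)
    (D : set T) : (forall i, measurable (F i)) ->
  trivIset [set: I] F -> D = \bigcup_i F i ->
  (mu D = \sum_i mu (F i))%E.
Proof.
move=> mF tF ->; rewrite measure_fin_bigcup//; last exact: finite_finset.
rewrite (fsbigTE [fset i in I]%fset) => [|i]; last by rewrite !inE.
rewrite (perm_big (index_enum I))//.
apply: uniq_perm; rewrite ?fset_uniq ?index_enum_uniq// => i.
by rewrite mem_index_enum !inE.
Qed.

(** * Poissonized samples *)

Section PoissonSample.
Context (R : realType) (S : countType) (mu : probability {fset S} R).
Context d (T : measurableType d) (P : probability T R).

Definition mass (A : set {fset S}) : R := fine (mu A).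

Lemma massE A : mu A = (mass A)%:E.
Proof. by rewrite /mass fineK// fin_num_measure. Qed.

(** All that is used of an expedition: the law of its size together with its
    first observations.  Random sample sizes [n] and [n + m] are then treated
    at once. *)
Record poisson_sample (L : T -> nat) (X : nat -> T -> {fset S}) (tau : R) :
    Prop := PoissonSample {
  sample_measurable : forall i A, measurable (X i @^-1` A) ;
  size_measurable : forall k, measurable (L @^-1` [set k]) ;
  sample_law : forall k (A : nat -> set {fset S}),
    P (L @^-1` [set k] `&` \bigcap_(i in `I_k) X i @^-1` A i) =
      (poisson_pmf tau k * \prod_(i < k) mass (A i))%:E }.

Lemma expeditions_law (t t' : R) (X : nat -> {RV P >-> {fset S}})
    (n m : {RV P >-> nat}) (U V : set nat) (k : nat) (A : nat -> set {fset S}) :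
  poissonized_expeditions mu t t' X n m ->
  P (n @^-1` U `&` (m @^-1` V `&` \bigcap_(i in `I_k) X i @^-1` A i)) =
  (P (n @^-1` U) * (P (m @^-1` V) * (\prod_(i < k) mass (A i))%:E))%E.
Proof.
case=> lX _ _ ind.
pose idx : seq (bool + nat) := inl false :: inl true :: map inr (iota 0 k).
have uidx : uniq idx.
  rewrite /= !inE /= map_inj_uniq ?iota_uniq//; last by move=> ? ? [].
  by rewrite andbT; apply/andP; split; apply/mapP => -[].
pose E (j : bool + nat) : set T := match j with
  | inl false => n @^-1` U | inl true => m @^-1` V
  | inr i => X i @^-1` A i end.
have := ind [fset j in idx]%fset E.
rewrite (perm_big idx)/=; last first.
  by apply: uniq_perm => //; [exact: fset_uniq|move=> j; rewrite !inE].
rewrite !big_cons big_map -[k in iota 0 k]subn0 -/(index_iota 0 k) big_mkord.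
rewrite (_ : \bigcap_(i in _) _ = n @^-1` U `&` (m @^-1` V `&`
    \bigcap_(i in `I_k) X i @^-1` A i)); last first.
  apply/seteqP; split => [w H|w [nU [mV XA]] j /=].
    split; [|split]; first by apply: (H (inl false)); rewrite /= !inE.
    - by apply: (H (inl true)); rewrite /= !inE.
    - move=> i /= ik; apply: (H (inr i)); rewrite /= !inE /=.
      by apply/mapP; exists i => //; rewrite mem_iota.
  rewrite !inE => /or3P[/eqP->|/eqP->|/mapP[i]] //.
  by rewrite mem_iota /= => ik ->; exact: XA.
move=> ->; last first.
  move=> j; rewrite !inE => /or3P[/eqP->|/eqP->|/mapP[i _ ->]] /=.
  - by exists U => //; rewrite setTI.
  - by exists V => //; rewrite setTI.
  - by exists (A i) => //; rewrite setTI.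
congr (_ * (_ * _))%E; rewrite -prodEFin.
by apply: eq_bigr => i _; rewrite /= lX massE.
Qed.

End PoissonSample.

Section FromExpeditions.
Context (R : realType) (S : countType) (mu : probability {fset S} R).
Context d (T : measurableType d) (P : probability T R).
Context (t t' : R) (X : nat -> {RV P >-> {fset S}}) (n m : {RV P >-> nat}).
Hypothesis exped : poissonized_expeditions mu t t' X n m.

Lemma measurable_RV d' (T' : measurableType d') (Y : {RV P >-> T'}) U :
  measurable U -> measurable (Y @^-1` U).
Proof. by move=> mU; rewrite -[X in measurable X]setTI; exact: measurable_funP. Qed.

Lemma first_sample : poisson_sample mu P n X t.
Proof.
split=> [i A|k|k A]; [exact: measurable_RV|exact: measurable_RV|].
have := expeditions_law [set k] setT k A exped.
rewrite preimage_setT setTI => ->; rewrite [X in (_ * (X * _))%E]probability_setT.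
by rewrite mul1e (first_size_law exped) -EFinM.
Qed.

(** The sum of the two sizes is again Poisson, by convolution, so the pooled
    expeditions are a single sample of parameter [t + t']. *)
Lemma total_sample : 0 < t -> 0 < t' ->
  poisson_sample mu P (fun w => (n w + m w)%N) X (t + t').
Proof.
move=> t0 t'0.
have split_total k : (fun w => (n w + m w)%N) @^-1` [set k] =
    \bigcup_(a : 'I_k.+1) (n @^-1` [set (a : nat)] `&` m @^-1` [set (k - a)%N]).
  apply/seteqP; split=> [w /= nmk|w [a _ [/= -> ->]]]; last first.
    by rewrite subnKC// -ltnS.
  have nk : (n w < k.+1)%N by rewrite ltnS -nmk leq_addr.
  by exists (Ordinal nk) => //=; split=> //; rewrite /= -nmk addKn.
split=> [i A|k|k A]; first exact: measurable_RV.
  rewrite split_total; apply: fin_bigcup_measurable; first exact: finite_finset.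
  by move=> a _; apply: measurableI; exact: measurable_RV.
rewrite (@measure_partition_fin _ _ _ P 'I_k.+1 (fun a =>
  n @^-1` [set (a : nat)] `&` (m @^-1` [set (k - a)%N] `&`
    \bigcap_(i in `I_k) X i @^-1` A i))).
- rewrite -poisson_pmf_convolution// mulr_suml -sumEFin.
  apply: eq_bigr => a _.
  rewrite [LHS](expeditions_law [set (a : nat)] [set (k - a)%N] _ _ exped).
  rewrite (first_size_law exped).
  by rewrite (second_size_law exped) -!EFinM mulrA.
- move=> a; apply: measurableI; first exact: measurable_RV.
  apply: measurableI; first exact: measurable_RV.
  by apply: fin_bigcap_measurable => // i _; exact: measurable_RV.
- by move=> a b _ _ [w [[/= -> _] [/= ab _]]]; exact: val_inj.
- by rewrite split_total setI_bigcupl; apply: eq_bigcupr => a _; rewrite setIA.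
Qed.

End FromExpeditions.

(** * Probabilities of void and singleton counts *)

Section Incidence.
Context (R : realType) (S : countType) (mu : probability {fset S} R).
Implicit Types (s u : S) (A C : set {fset S}).

Notation pr := (mass mu).
Definition incidence s : R := pr [set A : {fset S} | s \in A].
Definition coincidence s u : R := pr [set A : {fset S} | s \in A /\ u \in A].

Lemma mass_ge0 A : 0 <= pr A.
Proof. exact: fine_ge0. Qed.

Lemma massU A C : A `&` C = set0 -> pr (A `|` C) = pr A + pr C.
Proof.
by move=> AC; apply: EFin_inj; rewrite EFinD -!massE measureU.
Qed.

Lemma mass_setT : pr setT = 1.
Proof. by apply: EFin_inj; rewrite -massE probability_setT. Qed.

Lemma mass_in_out s u :
  pr [set A : {fset S} | s \in A /\ u \notin A] = incidence s - coincidence s u.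
Proof.
apply/eqP; rewrite eq_sym subr_eq -massU; last first.
  by apply/seteqP; split=> // A [/= [_ /negP uA] [_]].
apply/eqP; congr mass; apply/seteqP; split=> A /=; last by case=> -[].
by move=> sA; case: (boolP (u \in A)) => uA; [right|left].
Qed.

Lemma coincidenceC s u : coincidence s u = coincidence u s.
Proof. by congr mass; apply/seteqP; split=> A /= []. Qed.

Lemma mass_out_out s u : pr [set A : {fset S} | s \notin A /\ u \notin A] =
  1 - (incidence s + incidence u - coincidence s u).
Proof.
suff : 1 = pr [set A : {fset S} | s \notin A /\ u \notin A] +
    (incidence s + pr [set A : {fset S} | u \in A /\ s \notin A]).
  rewrite mass_in_out coincidenceC; lra.
rewrite /incidence -massU; last first.
  by apply/seteqP; split=> // A /= [sA [_ /negP]].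
rewrite -massU; last first.
  by apply/seteqP; split=> // A /= [[/negP sA /negP uA]] [|[]//].
rewrite -mass_setT; congr mass; apply/seteqP; split=> // A _ /=.
case: (boolP (s \in A)) => sA; first by right; left.
by case: (boolP (u \in A)) => uA; [right; right|left].
Qed.

End Incidence.

Section Sample.
Context (R : realType) (S : countType) (mu : probability {fset S} R).
Context d (T : measurableType d) (P : probability T R).
Context (L : T -> nat) (X : nat -> T -> {fset S}) (tau : R).
Hypothesis sampleLX : poisson_sample mu P L X tau.
Hypothesis tau0 : 0 < tau.

Notation pr := (mass mu).
Notation M := (incidence mu).
Notation M2 := (coincidence mu).
Notation N w s := (first_count (X ^~ w) (L w) s).

Definition seen s := [set w | (0 < N w s)%N].
Definition once s := [set w | N w s = 1%N].

Let measurable_prefix k (A : nat -> set {fset S}) :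
  measurable (L @^-1` [set k] `&` \bigcap_(i in `I_k) X i @^-1` A i).
Proof.
apply: measurableI; first exact: size_measurable sampleLX k.
by apply: fin_bigcap_measurable => // i _; exact: sample_measurable sampleLX i _.
Qed.

Lemma measurable_by_size (D : set T) :
  (forall k, measurable (D `&` L @^-1` [set k])) -> measurable D.
Proof.
move=> mD; rewrite (_ : D = \bigcup_k (D `&` L @^-1` [set k])).
  exact: bigcup_measurable.
by apply/seteqP; split=> [x Dx|x [k _ []]//]; exists (L x).
Qed.

(** Taking for [A] the finite sets that avoid given species expresses that
    these species have not been seen. *)
Definition confined (A : set {fset S}) := [set w | forall i, (i < L w)%N -> A (X i w)].

Let confined_size A k : confined A `&` L @^-1` [set k] =
  L @^-1` [set k] `&` \bigcap_(i in `I_k) X i @^-1` A.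
Proof.
apply/seteqP; split=> w [] /=.
  by move=> XA Lk; split=> // i /= ik; apply: XA; rewrite Lk.
by move=> Lk XA; split=> // i; rewrite Lk; exact: XA.
Qed.

Lemma measurable_confined A : measurable (confined A).
Proof. by apply: measurable_by_size => k; rewrite confined_size. Qed.

(** The observations outside [A] are a thinned sample, with a Poisson number of
    elements of mean [tau * (1 - mu A)]. *)
Lemma confined_prob A : P (confined A) = (expR (- (tau * (1 - pr A))))%:E.
Proof.
rewrite (@measure_partition_nat _ _ _ P L) => [|k]; last by rewrite confined_size.
rewrite -poisson_pgf ?mass_ge0//; apply: eq_eseriesr => k _.
rewrite confined_size; have /= -> := sample_law sampleLX k (fun=> A).
by rewrite prodr_const card_ord.
Qed.

Lemma count_eq0 w s : N w s = 0%N <-> forall i, (i < L w)%N -> s \notin X i w.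
Proof.
rewrite /first_count big_mkord; split=> [/eqP + i iL|H].
  rewrite sum_nat_eq0 => /forallP/(_ (Ordinal iL))/=.
  by case: (s \in X i w).
by apply: big1 => i _; rewrite (negbTE (H _ (ltn_ord i))).
Qed.

Lemma unseenI s u : ~` seen s `&` ~` seen u =
  confined [set A : {fset S} | s \notin A /\ u \notin A].
Proof.
apply/seteqP; split=> w /=.
  case=> /negP + /negP; rewrite -!eqn0Ngt => /eqP/count_eq0 sw /eqP/count_eq0 uw.
  by move=> i iL; split; [exact: sw|exact: uw].
move=> H; split; apply/negP; rewrite -eqn0Ngt; apply/eqP/count_eq0 => i iL;
  by have [] := H i iL.
Qed.

Lemma unseen_prob2 s u : P (~` seen s `&` ~` seen u) =
  (expR (- (tau * (M s + M u - M2 s u))))%:E.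
Proof.
by rewrite unseenI confined_prob mass_out_out; congr (expR (- (_ * _)))%:E; lra.
Qed.

Lemma coincidence_diag s : M2 s s = M s.
Proof. by congr mass; apply/seteqP; split=> [A []|A]. Qed.

Lemma measurable_seen s : measurable (seen s).
Proof.
rewrite (_ : seen s = ~` (~` seen s `&` ~` seen s)); last by rewrite setIid setCK.
by rewrite unseenI; apply: measurableC; exact: measurable_confined.
Qed.

Lemma seen_prob s : P (seen s) = (1 - expR (- (tau * M s)))%:E.
Proof.
rewrite -[seen s]setCK probability_setC; last first.
  by apply: measurableC; exact: measurable_seen.
by rewrite -[X in P X]setIid unseen_prob2 coincidence_diag addrK.
Qed.

Lemma seen_prob2 s u : P (seen s `&` seen u) =
  (1 - expR (- (tau * M s)) - expR (- (tau * M u))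
     + expR (- (tau * (M s + M u - M2 s u))))%:E.
Proof.
have mE := measurable_seen.
have := unseen_prob2 s u; rewrite -setCU probability_setC; last exact: measurableU.
have : (P (seen s `|` seen u) = P (seen s) + P (seen u) - P (seen s `&` seen u))%E.
  apply: measureUfinl => //; by rewrite ltey_eq fin_num_measure.
have fI : P (seen s `&` seen u) \is a fin_num.
  by apply: fin_num_measure; exact: measurableI.
have fU : P (seen s `|` seen u) \is a fin_num.
  by apply: fin_num_measure; exact: measurableU.
rewrite -(fineK fI) -(fineK fU) !seen_prob -EFinD -!EFinB => -[->] [e].
congr EFin; lra.
Qed.

(** The condition on the [l]-th observation saying that [s] occurs in the [i]-th
    one only, and [u] in the [j]-th one only. *)
Definition only_at (s u : S) (i j : nat) (l : nat) : set {fset S} :=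
  [set A : {fset S} | (s \in A) = (l == i) /\ (u \in A) = (l == j)].

Lemma count_eq1 (x : nat -> {fset S}) k s : first_count x k s = 1%N <->
  exists2 i, (i < k)%N & forall l, (l < k)%N -> (s \in x l) = (l == i).
Proof.
rewrite /first_count big_mkord; split=> [e|[i ik H]]; last first.
  rewrite (bigD1 (Ordinal ik))//= H// eqxx big1// => -[l lk] /=.
  by rewrite H// -val_eqE/= => /negbTE ->.
have [i0 si] : exists i : 'I_k, s \in x i.
  apply/existsP; apply: contraPT e; rewrite negb_exists => /forallP H.
  by rewrite big1// => i _; rewrite (negbTE (H i)).
exists i0 => // l lk; apply/idP/eqP => [sl|->//].
have [//|ne] := eqVneq l i0.
move: e; rewrite (bigD1 i0)//= si (bigD1 (Ordinal lk)) /=; last first.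
  by rewrite -val_eqE.
by rewrite sl.
Qed.

(** Two species are both seen exactly once when each has a well-defined place
    in the sample; fixing the two places leaves a rectangle, to which the law of
    the sample applies. *)
Lemma once2_size s u k : (once s `&` once u) `&` L @^-1` [set k] =
  \bigcup_(p : 'I_k * 'I_k) (L @^-1` [set k] `&`
    \bigcap_(l in `I_k) X l @^-1` only_at s u p.1 p.2 l).
Proof.
apply/seteqP; split=> w /=.
  move=> [[/count_eq1[i + H] /count_eq1[j + H']] Lk].
  rewrite Lk in H H' * => ik jk.
  exists (Ordinal ik, Ordinal jk) => //; split=> // l /= lk.
  by split; [exact: H|exact: H'].
move=> [[i j] _ /= [Lk H]]; rewrite /once /= Lk; split=> //; split; apply/count_eq1.
  by exists i => // l lk; have [] := H l lk.
by exists j => // l lk; have [] := H l lk.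
Qed.

Lemma mass_only_at s u i j l : pr (only_at s u i j l) =
  if l == i then if l == j then M2 s u else M s - M2 s u
  else if l == j then M u - M2 s u else 1 - (M s + M u - M2 s u).
Proof.
rewrite /only_at; case: (l == i); case: (l == j).
- by congr mass.
- rewrite -mass_in_out; congr mass.
  by apply/seteqP; split=> A /= [sA uA]; split=> //; [rewrite uA|exact/negbTE].
- rewrite [M2 s u]coincidenceC -mass_in_out; congr mass.
  by apply/seteqP; split=> A /= [sA uA]; split=> //; [rewrite sA|exact/negbTE].
- rewrite -mass_out_out; congr mass.
  apply/seteqP; split=> A /= [sA uA]; first by rewrite sA uA.
  by split; exact/negbTE.
Qed.

Lemma prod_mass_only_at s u k (i j : 'I_k) :
  \prod_(l < k) pr (only_at s u i j l) =
  if i == j then M2 s u * (1 - (M s + M u - M2 s u)) ^+ k.-1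
  else (M s - M2 s u) * (M u - M2 s u) * (1 - (M s + M u - M2 s u)) ^+ k.-2.
Proof.
have cst (q : R) (A : pred 'I_k) (F : 'I_k -> R) r : #|A| = r ->
    (forall l, A l -> F l = q) -> \prod_(l | A l) F l = q ^+ r.
  by move=> <- H; rewrite -prodr_const; apply: eq_bigr.
case: eqVneq => [<-|ij].
  rewrite (bigD1 i)//= mass_only_at eqxx; congr (_ * _).
  apply: cst => [|l]; first by rewrite cardC1 card_ord.
  by rewrite mass_only_at -val_eqE => /negbTE ->.
rewrite (bigD1 i)//= (bigD1 j) 1?eq_sym//= !mass_only_at !eqxx !val_eqE.
rewrite (negbTE ij) eq_sym (negbTE ij) mulrA; congr (_ * _).
apply: cst => [|l /andP[li lj]]; last first.
  by rewrite mass_only_at !val_eqE (negbTE li) (negbTE lj).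
have := cardC (pred2 i j); rewrite card2 ij card_ord => /= e.
rewrite (eq_card (B := predC (pred2 i j))); last first.
  by move=> l; rewrite !inE negb_or.
exact: (congr1 (fun x => x.-2) e).
Qed.

Lemma once2_size_prob s u k : P ((once s `&` once u) `&` L @^-1` [set k]) =
  (poisson_pmf tau k * (M2 s u * (k%:R * (1 - (M s + M u - M2 s u)) ^+ k.-1) +
     (M s - M2 s u) * (M u - M2 s u) *
       ((k * k.-1)%:R * (1 - (M s + M u - M2 s u)) ^+ k.-2)))%:E.
Proof.
rewrite (measure_partition_fin P _ _ (once2_size s u k)) => [|p|]; last 2 first.
- exact: measurable_prefix.
- move=> [i j] [i' j'] _ _ [w /= [[Lk H] [_ H']]].
  have [ik _] := H i (ltn_ord i); have [_ jk] := H j (ltn_ord j).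
  have [+ _] := H' i (ltn_ord i); have [_ +] := H' j (ltn_ord j).
  rewrite /= ik jk !eqxx !val_eqE => /esym/eqP -> /esym/eqP ->.
  by [].
transitivity (\sum_(p : 'I_k * 'I_k) (poisson_pmf tau k *
    \prod_(l < k) pr (only_at s u p.1 p.2 l))%:E)%E.
  by apply: eq_bigr => p _; exact: (sample_law sampleLX).
under eq_bigr do rewrite prod_mass_only_at.
rewrite sumEFin -mulr_sumr; congr (_ * _)%:E.
set q := 1 - _; set a := M2 s u; set b := (M s - a) * (M u - a).
have /= <- := pair_bigA _
  (fun i j : 'I_k => if i == j then a * q ^+ k.-1 else b * q ^+ k.-2).
transitivity (\sum_(i < k) (a * q ^+ k.-1 + b * q ^+ k.-2 *+ k.-1)).
  apply: eq_bigr => i _; rewrite (bigD1 i)//= eqxx; congr (_ + _).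
  rewrite (eq_bigr (fun=> b * q ^+ k.-2)) => [|j]; last by rewrite eq_sym => /negbTE ->.
  by rewrite sumr_const cardC1 card_ord.
by rewrite sumr_const card_ord -(mulr_natr (b * _)) -(mulr_natr (_ + _)) natrM; ring.
Qed.

Lemma measurable_once s : measurable (once s).
Proof.
rewrite -[once s]setIid; apply: measurable_by_size => k; rewrite once2_size.
apply: fin_bigcup_measurable => [|p _]; first exact: finite_finset.
exact: measurable_prefix.
Qed.

Lemma coincidence_le s u : M2 s u <= M s.
Proof. by rewrite -subr_ge0 -mass_in_out mass_ge0. Qed.

(** The two terms correspond to one observation that contains both species and
    to two distinct observations that contain one each.  The case [s = u] gives
    the probability for a single species. *)
Lemma once_prob2 s u : P (once s `&` once u) =
  ((tau * M2 s u + (tau * (M s - M2 s u)) * (tau * (M u - M2 s u))) *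
     expR (- (tau * (M s + M u - M2 s u))))%:E.
Proof.
have q0 : 0 <= 1 - (M s + M u - M2 s u) by rewrite -mass_out_out mass_ge0.
have a0 : 0 <= M2 s u by exact: mass_ge0.
have b0 : 0 <= (M s - M2 s u) * (M u - M2 s u).
  by rewrite mulr_ge0// subr_ge0 ?coincidence_le// coincidenceC coincidence_le.
rewrite (@measure_partition_nat _ _ _ P L) => [|k]; last first.
  rewrite once2_size; apply: fin_bigcup_measurable => [|p _]; first exact: finite_finset.
  exact: measurable_prefix.
transitivity (\sum_(k <oo)
   ((poisson_pmf tau k * (M2 s u * (k%:R * (1 - (M s + M u - M2 s u)) ^+ k.-1)))%:E
   + (poisson_pmf tau k * ((M s - M2 s u) * (M u - M2 s u) *
       ((k * k.-1)%:R * (1 - (M s + M u - M2 s u)) ^+ k.-2)))%:E))%E.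
  apply: eq_eseriesr => k _; rewrite -EFinD -mulrDr.
  exact: once2_size_prob.
rewrite nneseriesD; last 2 first.
- by move=> k _ _; rewrite lee_fin !mulr_ge0 ?poisson_pmf_ge0 ?exprn_ge0.
- by move=> k _ _; rewrite lee_fin mulr_ge0 ?poisson_pmf_ge0//
    mulr_ge0// mulr_ge0// exprn_ge0.
under eq_eseriesr do rewrite mulrCA EFinM.
rewrite nneseriesZl => [|k _]; last first.
  by rewrite lee_fin !mulr_ge0 ?poisson_pmf_ge0 ?exprn_ge0.
rewrite poisson_pgf_deriv1//.
under [X in (_ + X)%E]eq_eseriesr do rewrite mulrCA EFinM.
rewrite nneseriesZl => [|k _]; last first.
  by rewrite lee_fin !mulr_ge0 ?poisson_pmf_ge0 ?exprn_ge0.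
rewrite poisson_pgf_deriv2// -!EFinM -EFinD subKr; congr EFin; ring.
Qed.

Lemma once_prob s : P (once s) = (tau * M s * expR (- (tau * M s)))%:E.
Proof.
by rewrite -[once s]setIid once_prob2 coincidence_diag subrr !mulr0 addr0 addrK.
Qed.

End Sample.

(** * Covariances and concentration of the statistics *)

Section CovarianceBounds.
Context (R : realType).
Implicit Types a b k x : R.

Lemma expRN_le_inv x : 0 <= x -> expR (- x) <= (1 + x)^-1.
Proof.
move=> x0; rewrite expRN lef_pV2 ?posrE ?expR_gt0 ?ltr_pwDl//.
exact: expR_ge1Dx.
Qed.

(** [27] comes from expanding [(1 + x / 3) ^+ 3], a lower bound of [expR x] in
    which every coefficient is at least [1 / 27]. *)
Lemma cubic_le_expR x : 0 <= x -> (1 + x ^+ 2) * (1 + x) <= 27 * expR x.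
Proof.
move=> x0.
have -> : expR x = expR (x / 3) ^+ 3.
  by rewrite -expRM_natl; congr expR; field.
have e1 : 1 + x / 3 <= expR (x / 3) by apply: expR_ge1Dx; lra.
have : (1 + x / 3) ^+ 3 <= expR (x / 3) ^+ 3.
  by apply: lerXn2r => //; rewrite nnegrE; [lra|exact: expR_ge0].
nra.
Qed.

Lemma expR_diff_le a b k : 0 <= k ->
  expR (- (a + b - k)) - expR (- a) * expR (- b) <= k * expR (- (a + b - k)).
Proof.
move=> k0.
have -> : expR (- a) * expR (- b) = expR (- (a + b - k)) * expR (- k).
  by rewrite -!expRD; congr expR; ring.
have := expR_ge1Dx (- k); have := expR_ge0 (- (a + b - k)); nra.
Qed.

Lemma expR_overlap_le a b k : 0 <= a -> 0 <= b -> k <= a -> k <= b ->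
  (1 + a * b) * (1 + a) * expR (- (a + b - k)) <= 27.
Proof.
move=> a0 b0 ka kb; pose x := Num.max a b.
have [ax bx] : a <= x /\ b <= x by rewrite !le_max !lexx orbT.
have Ex : expR (- (a + b - k)) <= expR (- x).
  rewrite ler_expR /x; case: (leP a b) => _; lra.
apply: (@le_trans _ _ ((1 + x ^+ 2) * (1 + x) * expR (- x))).
  apply: ler_pM => //; first by rewrite !mulr_ge0// addr_ge0// mulr_ge0.
  - apply: ler_pM; rewrite ?addr_ge0 ?mulr_ge0// ?lerD2l//.
    by rewrite expr2; apply: ler_pM.
have x0 : 0 <= x by lra.
by rewrite expRN ler_pdivrMr ?expR_gt0// cubic_le_expR.
Qed.

(** For two species with Poisson means [a] and [b] whose common part has mean
    [k], the left-hand side is the covariance of the indicators of being unseen.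
    The factor [1 / (1 + a)] is chosen because [a / (1 + a) <= 1 - e^-a], which
    makes the bounds summable over the species. *)
Lemma void_covariance_le a b k : 0 <= k -> k <= a -> k <= b ->
  expR (- (a + b - k)) - expR (- a) * expR (- b) <= 27 * k / (1 + a).
Proof.
move=> k0 ka kb; have a0 : 0 <= a by lra. have b0 : 0 <= b by lra.
apply: (le_trans (expR_diff_le a b k0)).
rewrite ler_pdivlMr ?ltr_pwDl// -mulrA [27 * k]mulrC ler_wpM2l//.
have := expR_overlap_le a0 b0 ka kb.
have := expR_ge0 (- (a + b - k)).
have : 0 <= a * b by rewrite mulr_ge0.
move: (a * b) (expR _) => ab E ab0 E0.
have : 0 <= ab * ((1 + a) * E) by rewrite !mulr_ge0// addr_ge0.
nra.
Qed.

(** Same as [void_covariance_le], for the indicators of being seen exactly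
    once. *)
Lemma singleton_covariance_le a b k : 0 <= k -> k <= a -> k <= b ->
  (k + (a - k) * (b - k)) * expR (- (a + b - k))
    - a * expR (- a) * (b * expR (- b)) <= 27 * k / (1 + a).
Proof.
move=> k0 ka kb; have a0 : 0 <= a by lra. have b0 : 0 <= b by lra.
have ab0 : 0 <= a * b by rewrite mulr_ge0.
apply: (@le_trans _ _ (k * (1 + a * b) * expR (- (a + b - k)))).
  have := expR_diff_le a b k0; have := expR_ge0 (- (a + b - k)).
  rewrite mulrACA; move: (expR (- (a + b - k))) (expR (- a) * _) => E F E0 EF.
  have : 0 <= a * b * (k * E - (E - F)) by rewrite mulr_ge0// subr_ge0.
  have : 0 <= (a * b - (a - k) * (b - k)) * E by rewrite mulr_ge0//; nra.
  nra.
rewrite ler_pdivlMr ?ltr_pwDl// [27 * k]mulrC -!mulrA ler_wpM2l//.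
by rewrite [X in _ * X]mulrC mulrA expR_overlap_le.
Qed.

End CovarianceBounds.

Section Overlap.
Context (R : realType) (S : countType) (mu : probability {fset S} R) (B : nat).
Hypothesis muB : card_bounded mu B.
Local Open Scope ereal_scope.

(** The sum is the integral of the cardinal of [A] over the sets [A] containing
    [s], and almost every set has at most [B] elements. *)
Lemma coincidence_sum s : \esum_(u in [set: S]) (coincidence mu s u)%:E
  <= (B%:R * incidence mu s)%:E.
Proof.
pose G : set {fset S} := [set A | (#|` A| <= B)%N].
have muG F : mu F = mu (F `&` G).
  rewrite measure_atoms (esumID G)// [X in _ + X]esum1 ?adde0 -?measure_atoms//.
  by move=> A [_ /= /negP]; rewrite -ltnNge; exact: muB.
pose D : set {fset S} := [set A : {fset S} | s \in A] `&` G.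
apply: (@le_trans _ _ (\int[mu]_(A in D) (#|` A|%:R)%:E)).
  rewrite [leRHS](_ : _ = \int[mu]_(A in D)
      \esum_(u in [set: S]) (\1_[set` A] u)%:E); last first.
    by apply: eq_integral => A _; rewrite esum_indic ?set_fsetK//.
  rewrite integral_esum//.
  apply: le_esum => u _; rewrite -massE muG.
  rewrite (_ : (fun A => _) = (fun A => (\1_[set A : {fset S} | u \in A] A)%:E)).
    rewrite integral_indic//; apply: le_measure; rewrite ?inE//.
    by move=> A [/= [sA uA] GA].
  by apply/funext => A; rewrite !indicE; congr (nat_of_bool _)%:R%:E.
apply: (@le_trans _ _ (\int[mu]_(A in D) (B%:R)%:E)).
  apply: ge0_le_integral => //.
  by move=> A [_ /=]; rewrite lee_fin ler_nat.
rewrite integral_cst// EFinM lee_wpmul2l// -massE.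
by apply: le_measure; rewrite ?inE//; exact: subIsetl.
Qed.

End Overlap.

Lemma singletons_firstE (S : countType) (x : nat -> {fset S}) j : singletons_first x j =
  #|` fset_set [set s | first_count x j s == 1%N]|.
Proof.
by rewrite /singletons_first; congr (#|` fset_set _|); apply/seteqP; split=> s /= /eqP.
Qed.

Section Concentration.
Context (R : realType) (S : countType) (mu : probability {fset S} R) (B : nat).
Hypothesis muB : card_bounded mu B.
Context d (T : measurableType d) (P : probability T R).
Context (L : T -> nat) (X : nat -> T -> {fset S}) (tau : R).
Hypothesis sampleLX : poisson_sample mu P L X tau.
Hypothesis tau0 : 0 < tau.

Notation M := (incidence mu).
Notation M2 := (coincidence mu).

Let k (s u : S) : \bar R := (27 * (tau * M2 s u) / (1 + tau * M s))%:E.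

Let tM0 s : 0 <= tau * M s.
Proof. by rewrite mulr_ge0 ?mass_ge0// ltW. Qed.

Let tM20 s u : 0 <= tau * M2 s u.
Proof. by rewrite mulr_ge0 ?mass_ge0// ltW. Qed.

Let tM2l s u : tau * M2 s u <= tau * M s.
Proof. by rewrite ler_wpM2l ?coincidence_le// ltW. Qed.

Let tM2r s u : tau * M2 s u <= tau * M u.
Proof. by rewrite coincidenceC. Qed.

Let k_ge0 s u : (0 <= k s u)%E.
Proof. by rewrite lee_fin divr_ge0 ?mulr_ge0 ?addr_ge0 ?tM0 ?mass_ge0// ltW. Qed.

Let k_sum f :
  (\esum_(s in [set: S]) (1 - expR (- (tau * M s)))%:E = f%:E)%E ->
  (\esum_(s in [set: S]) \esum_(u in [set: S]) k s u <= (27 * B%:R * f)%:E)%E.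
Proof.
move=> fE.
apply: (@le_trans _ _ (\esum_(s in [set: S])
    ((27 * B%:R)%:E * (1 - expR (- (tau * M s)))%:E))%E); last first.
  rewrite esumZl ?fE ?mulr_ge0// => s.
  by rewrite lee_fin subr_ge0 expR_le1 oppr_le0.
apply: le_esum => s _.
rewrite (eq_esum (b := fun u => ((27 * tau / (1 + tau * M s))%:E * (M2 s u)%:E)%E));
  last by move=> u _; rewrite /k -EFinM; congr EFin; ring.
have p1 : 0 < 1 + tau * M s by rewrite ltr_pwDl.
rewrite esumZl; last 2 first.
- by rewrite divr_ge0 ?ltW// mulr_gt0.
- by move=> u; rewrite lee_fin mass_ge0.
apply: (le_trans (lee_wpmul2l _ (coincidence_sum muB s))).
  by rewrite lee_fin divr_ge0 ?ltW// mulr_gt0.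
rewrite -!EFinM lee_fin.
have inv_le := expRN_le_inv (tM0 s).
rewrite [X in X <= _](_ : _ = 27 * B%:R * (1 - (1 + tau * M s)^-1)); last first.
  by field; rewrite gt_eqF.
by rewrite ler_wpM2l ?mulr_ge0// lerD2l lerN2.
Qed.

(** Common part of the two concentration results.  The mean number [v] of seen
    species also controls the variance of the number of singletons. *)
Lemma count_concentration (p : pred nat) (f v l : R) : ~~ p 0%N ->
  (forall s, measurable [set w | p (first_count (X ^~ w) (L w) s)]) ->
  (\esum_(s in [set: S]) P [set w | p (first_count (X ^~ w) (L w) s)] = f%:E)%E ->
  (forall s u, P ([set w | p (first_count (X ^~ w) (L w) s)] `&`
                 [set w | p (first_count (X ^~ w) (L w) u)]) <=
     P [set w | p (first_count (X ^~ w) (L w) s)] *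
     P [set w | p (first_count (X ^~ w) (L w) u)] + k s u)%E ->
  (\esum_(s in [set: S]) (1 - expR (- (tau * M s)))%:E = v%:E)%E -> 0 < l ->
  (P [set w |
      (l <= `| #|` fset_set [set s | p (first_count (X ^~ w) (L w) s)]|%:R - f|)%R]
     <= (27 * B%:R * v / l ^+ 2)%:E)%E.
Proof.
move=> p0 mE Ef Ek vE l0.
apply: (second_moment_concentration mE _ Ef k_ge0 Ek (k_sum vE) l0) => w.
rewrite -esum_indic; last exact: finite_first_count.
by apply: eq_esum => s _; rewrite !indicE.
Qed.

Lemma seen_concentration (f l : R) :
  (\esum_(s in [set: S]) (1 - expR (- (tau * M s)))%:E = f%:E)%E -> 0 < l ->
  (P [set w | (l <= `| (species_first (X ^~ w) (L w))%:R - f|)%R]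
     <= (27 * B%:R * f / l ^+ 2)%:E)%E.
Proof.
move=> fE l0; apply: (count_concentration (p := fun j => 0 < j)%N) => //.
- exact: measurable_seen sampleLX.
- by rewrite -fE; apply: eq_esum => s _; exact: (seen_prob sampleLX).
- move=> s u; rewrite [leLHS](seen_prob2 sampleLX tau0) !(seen_prob sampleLX tau0).
  rewrite -EFinM -EFinD lee_fin.
  have := void_covariance_le (tM20 s u) (tM2l s u) (tM2r s u).
  rewrite -mulrDr -mulrBr; lra.
Qed.

Lemma once_concentration (f g l : R) :
  (\esum_(s in [set: S]) (1 - expR (- (tau * M s)))%:E = f%:E)%E ->
  (\esum_(s in [set: S]) (tau * M s * expR (- (tau * M s)))%:E = g%:E)%E ->
  0 < l ->
  (P [set w | (l <= `| (singletons_first (X ^~ w) (L w))%:R - g|)%R]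
     <= (27 * B%:R * f / l ^+ 2)%:E)%E.
Proof.
move=> fE gE l0.
have e1 s : [set w | first_count (X ^~ w) (L w) s == 1%N] = once L X s.
  by apply/seteqP; split=> w /= /eqP.
under eq_set do rewrite singletons_firstE.
apply: (count_concentration (p := pred1 1%N)) => //.
- by move=> s; rewrite e1; exact: measurable_once sampleLX _.
- by rewrite -gE; apply: eq_esum => s _; rewrite e1 (once_prob sampleLX tau0).
- move=> s u; rewrite !e1 (once_prob2 sampleLX tau0) !(once_prob sampleLX tau0).
  rewrite -EFinM -EFinD lee_fin.
  have := singleton_covariance_le (tM20 s u) (tM2l s u) (tM2r s u).
  rewrite -mulrDr -!mulrBr; lra.
Qed.

End Concentration.

(** * Layer cake formula in logarithmic scale *)

Section Weights.
Context (R : realType).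
Notation leb := (@lebesgue_measure R).
Implicit Types x y z b : R.

(** The thresholds [x] at which [nu] is evaluated are written [e^-z / tau], so
    that a change of [tau] is a translation of [z] and the integrals need no
    change of variables.  The measures [e^-u du] and [u e^-u du], with
    [u = e^-z], have densities [weight 0] and [weight 1] in [z]. *)
Definition weight (i : nat) z : R := expR (- z) ^+ i.+1 * expR (- expR (- z)).

(** The probabilities that a Poisson variable of mean [y] is positive, for
    [i = 0], and at least [2], for [i = 1].  Their difference is the probability
    of being [1]; unlike the latter, both are increasing in [y], hence integrals
    of nonnegative weights. *)
Definition profile (i : nat) y : R :=
  1 - (if i is 0%N then 1 else 1 + y) * expR (- y).

Lemma weight_ge0 i z : 0 <= weight i z.
Proof. by rewrite mulr_ge0 ?exprn_ge0 ?expR_ge0. Qed.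

Lemma is_derive_expR_comp (g : R -> R) z (l : R) :
  is_derive z 1 g l -> is_derive z 1 (fun y => expR (g y)) (l * expR (g z)).
Proof.
move=> dg; rewrite mulrC.
exact: (@is_derive1_comp R expR g z _ _ (is_derive_expR (g z)) dg).
Qed.

Lemma is_derive_uN z : is_derive z 1 (fun z => expR (- z)) (- expR (- z)).
Proof.
rewrite -mulN1r; exact: (is_derive_expR_comp (is_deriveNid z 1)).
Qed.

Lemma is_derive_profile0 z :
  is_derive z 1 (fun z => expR (- expR (- z))) (weight 0 z).
Proof.
have d : is_derive z 1 (fun z => - expR (- z)) (expR (- z)).
  by rewrite -[X in is_derive _ _ _ X]opprK; exact: (is_deriveN (is_derive_uN z)).
exact: (is_derive_expR_comp d).
Qed.

Lemma is_derive_mul (f g : R -> R) z (l k : R) : is_derive z 1 f l ->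
  is_derive z 1 g k -> is_derive z 1 (fun y => f y * g y) (l * g z + f z * k).
Proof.
move=> df dg; have := is_deriveM df dg.
by rewrite /GRing.scale /= addrC [g z * l]mulrC.
Qed.

Lemma is_derive_profile1 z :
  is_derive z 1 (fun z => (1 + expR (- z)) * expR (- expR (- z))) (weight 1 z).
Proof.
have d : is_derive z 1 (fun z => 1 + expR (- z)) (- expR (- z)).
  have := is_deriveD (is_derive_cst (1 : R) z (1 : R)) (is_derive_uN z).
  by rewrite add0r.
have := is_derive_mul d (is_derive_profile0 z).
rewrite (_ : _ + _ = weight 1 z)// /weight !exprS expr0; ring.
Qed.

(** [tilted b i] is [u^(i-b) e^-u du] in the variable [z], with [u = e^-z]. *)
Definition tilted b (i : nat) z : R := expR (b * z) * weight i z.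

Lemma tilted_ge0 b i z : 0 <= tilted b i z.
Proof. by rewrite mulr_ge0 ?expR_ge0 ?weight_ge0. Qed.

Lemma is_derive_linear b z : is_derive z 1 (fun y => b * y) b.
Proof.
have := is_derive_mul (is_derive_cst b z 1) (is_derive_id z 1).
by rewrite mul0r add0r mulr1.
Qed.

(** The integration by parts behind [Gamma(2 - b) = (1 - b) Gamma(1 - b)]. *)
Lemma is_derive_tilted b z : is_derive z 1 (tilted b 0)
  (tilted b 1 z - (1 - b) * tilted b 0 z).
Proof.
have dw := is_derive_mul (is_derive_uN z) (is_derive_profile0 z).
have := is_derive_mul (is_derive_expR_comp (is_derive_linear b z)) dw.
rewrite (_ : _ + _ = tilted b 1 z - (1 - b) * tilted b 0 z).
  by [].
rewrite /tilted /weight !exprS expr0; ring.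
Qed.

Lemma is_derive_continuous (f : R -> R) (l : R -> R) :
  (forall z, is_derive z 1 f (l z)) -> continuous f.
Proof.
move=> df z; apply: differentiable_continuous; apply/derivable1_diffP.
by have [] := df z.
Qed.

Lemma continuous_weight i : continuous (weight i).
Proof.
move=> z; apply: (@continuousM _ _ (fun z => expR (- z) ^+ i.+1)
   (fun z => expR (- expR (- z)))); last first.
  by apply: is_derive_continuous => y; exact: is_derive_profile0.
apply: (@continuous_comp _ _ _ (fun z => expR (- z)) (fun x => x ^+ i.+1));
  last exact: exprn_continuous.
by apply: is_derive_continuous => y; exact: is_derive_uN.
Qed.

Lemma continuous_tilted b i : continuous (tilted b i).
Proof.
move=> z; apply: (@continuousM _ _ (fun z => expR (b * z)) (weight i)).
  by apply: is_derive_continuous => y;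
    exact: (is_derive_expR_comp (is_derive_linear b y)).
exact: continuous_weight.
Qed.

Lemma measurable_tilted b i : measurable_fun setT (tilted b i).
Proof. apply: continuous_measurable_fun; exact: continuous_tilted. Qed.

Lemma measurable_weight i : measurable_fun setT (weight i).
Proof. apply: continuous_measurable_fun; exact: continuous_weight. Qed.

Lemma cvg_uN : expR (- z) @[z --> +oo] --> (0 : R).
Proof. exact: cvgr_expR. Qed.

Lemma cvg_profile0 : expR (- expR (- z)) @[z --> +oo] --> (1 : R).
Proof.
rewrite -[X in _ --> X]expR0 -[X in expR X]oppr0.
apply: (@continuous_cvg _ _ _ _ _ _ (fun x : R => expR (- x))); last exact: cvg_uN.
by apply: is_derive_continuous => y; exact: is_derive_uN.
Qed.

Definition primitive (i : nat) z : R :=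
  (if i is 0%N then 1 else 1 + expR (- z)) * expR (- expR (- z)).

Lemma is_derive_primitive i z : (i <= 1)%N ->
  is_derive z 1 (primitive i) (weight i z).
Proof.
case: i => [|[|//]] _; last exact: is_derive_profile1.
rewrite (_ : primitive 0 = fun z => expR (- expR (- z))).
  exact: is_derive_profile0.
by apply/funext => y; rewrite /primitive mul1r.
Qed.

Lemma cvg_primitive i : primitive i z @[z --> +oo] --> (1 : R).
Proof.
rewrite -[X in _ --> X]mulr1; apply: cvgM; last exact: cvg_profile0.
case: i => [|i]; first exact: cvg_cst.
by rewrite -[X in _ --> X]addr0; apply: cvgD; [exact: cvg_cst|exact: cvg_uN].
Qed.

Lemma layer_cake i y : (i <= 1)%N -> 0 <= y ->
  (\int[leb]_z (weight i z * (expR (- z) < y)%R%:R)%:E = (profile i y)%:E)%E.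
Proof.
move=> i1; rewrite le_eqVlt => /predU1P[<-|y0].
  rewrite integral0_eq => [|z _]; last by rewrite ltNge (expR_ge0 (- z)) mulr0.
  by rewrite /profile oppr0 expR0 mulr1; case: i i1 => [|i] _; rewrite ?addr0 subrr.
have uln z : (expR (- z) < y) = (- ln y < z).
  by rewrite -{1}(lnK y0) ltr_expR ltrNl.
transitivity (\int[leb]_(z in `](- ln y)%R, +oo[) (weight i z)%:E)%E.
  rewrite [RHS]integral_mkcond; apply: eq_integral => z _.
  rewrite patchE mem_setE in_itv/= andbT uln.
  by case: ifP => _; rewrite ?mulr1 ?mulr0.
rewrite integral_itv_obnd_cbnd; last first.
  by apply/measurable_EFinP; apply: measurable_funTS; exact: measurable_weight.
rewrite (@ge0_continuous_FTC2y _ _ (primitive i) _ 1).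
- rewrite /primitive /profile opprK lnK// -EFinB.
- by move=> x _; exact: weight_ge0.
- by apply: continuous_subspaceT; exact: continuous_weight.
- exact: cvg_primitive.
- by move=> x _; have [] := is_derive_primitive x i1.
- apply: cvg_at_right_filter.
  by apply: is_derive_continuous => x; exact: is_derive_primitive.
- by move=> x _; rewrite derive1E; have [_ ->] := is_derive_primitive x i1.
Qed.

End Weights.

(** * The Gamma integrals *)

Section TiltedMass.
Context (R : realType).
Notation leb := (@lebesgue_measure R).
Implicit Types x y z b : R.

Definition window (n : nat) : set R := [set` `[- n.+1%:R, n.+1%:R]].

Lemma window_FTC (f F : R -> R) n : continuous f ->
  (forall z, is_derive z 1 F (f z)) ->
  (\int[leb]_(z in window n) (f z)%:E = (F n.+1%:R - F (- n.+1%:R))%:E)%E.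
Proof.
move=> cf dF; rewrite /window (@continuous_FTC2 _ f F) ?EFinB//.
- by have : 0 < n.+1%:R :> R by []; lra.
- exact: continuous_subspaceT.
- split=> [x _||]; first by have [] := dF x.
  + by apply: cvg_at_right_filter; exact: is_derive_continuous dF _.
  + by apply: cvg_at_left_filter; exact: is_derive_continuous dF _.
- by move=> x _; rewrite derive1E; have [_ ->] := dF x.
Qed.

Lemma window_cvg (f : R -> \bar R) : measurable_fun setT f ->
  (forall z, 0 <= f z)%E ->
  (\int[leb]_(z in window n) f z)%E @[n --> \oo] --> (\int[leb]_z f z)%E.
Proof.
move=> mf f0.
have -> : [set: R] = \bigcup_n window n.
  apply/seteqP; split=> // z _; exists (Num.truncn `|z|) => //=.
  by rewrite /window /= in_itv /= -ler_norml; apply/ltW; exact: truncnS_gt.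
apply: ge0_nondecreasing_set_cvg_integral => //.
- move=> i j ij; apply/subsetPset => z; rewrite /window /= !in_itv/= => /andP[l r].
  have ij' : (i.+1%:R <= j.+1%:R :> R) by rewrite ler_nat.
  by apply/andP; split; lra.
- by move=> i; exact: measurable_itv.
- by move=> i; exact: measurable_funTS.
Qed.

(** [Gamma(1 - b)]. *)
Definition tilted_mass b : R := fine (\int[leb]_z (tilted b 0 z)%:E)%E.

Lemma measurable_Etilted b i (D : set R) :
  measurable_fun D (fun z => (tilted b i z)%:E : \bar R).
Proof. by apply/measurable_EFinP/measurable_funTS; exact: measurable_tilted. Qed.

(** The integrand in [z] is [u^(1-b) e^-u].  For [u >= 1] it is at most [u e^-u];
    for [u <= 1] it is at most [v = u^(1-b)], and [v <= e v e^-v] since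
    [v <= 1].  Both bounds have bounded explicit primitives in [z]. *)
Lemma tilted_window_bounded b n : b < 1 -> 0 < b ->
  (\int[leb]_(z in window n) (tilted b 0 z)%:E
     <= (1 + expR 1 / (1 - b))%:E)%E.
Proof.
move=> b1 b0; have b1' : 0 < 1 - b by lra.
pose v z := expR (- (1 - b) * z).
pose Fv z := expR 1 / (1 - b) * expR (- v z).
pose fv z := expR 1 * (v z * expR (- v z)).
have dv z : is_derive z 1 v (- (1 - b) * v z).
  exact: (is_derive_expR_comp (is_derive_linear (- (1 - b)) z)).
have dFv z : is_derive z 1 Fv (fv z).
  have dNv : is_derive z 1 (fun z => - v z) ((1 - b) * v z).
    by have := is_deriveN (dv z); rewrite mulNr opprK.
  have := is_derive_mul (is_derive_cst (expR 1 / (1 - b)) z (1 : R))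
    (is_derive_expR_comp dNv).
  rewrite mul0r add0r [X in is_derive _ _ _ X -> _](_ : _ = fv z)// /fv /cst /=.
  by field; lra.
have cfv : continuous fv.
  have cv : continuous v by apply: is_derive_continuous dv.
  have ce : continuous (fun z => expR (- v z)).
    move=> z; apply: (@continuous_comp _ _ _ v (fun x => expR (- x))); first exact: cv.
    by apply: is_derive_continuous => y; exact: is_derive_uN.
  move=> z; apply: (@continuousM _ _ (cst (expR 1)) (fun z => v z * expR (- v z))).
    exact: cst_continuous.
  by apply: continuousM; [exact: cv|exact: ce].
have fv0 z : 0 <= fv z by rewrite !mulr_ge0 ?expR_ge0.
apply: (@le_trans _ _ (\int[leb]_(z in window n) (weight 0 z + fv z)%:E)%E).
  apply: ge0_le_integral => //.
  - exact: measurable_itv.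
  - by move=> z _; rewrite lee_fin tilted_ge0.
  - exact: measurable_Etilted.
  - apply/measurable_EFinP/measurable_funTS; apply: measurable_funD.
      exact: measurable_weight.
    exact: continuous_measurable_fun.
  - move=> z _; rewrite lee_fin /tilted /fv /v.
    have [z0|z0] := leP z 0.
      rewrite -[leLHS]addr0 lerD//.
      by rewrite ler_piMl ?weight_ge0// expR_le1; nra.
    rewrite -[leLHS]add0r lerD ?weight_ge0// /weight expr1 mulrA -expRD.
    rewrite (_ : b * z - z = - (1 - b) * z); last by ring.
    rewrite mulrCA ler_wpM2l ?expR_ge0// -expRD ler_expR.
    have := expR_ge0 (- z).
    have : expR (- (1 - b) * z) <= 1 by rewrite expR_le1; nra.
    lra.
have cw : continuous (fun z => weight 0 z + fv z).
  by move=> z; apply: continuousD; [exact: continuous_weight|exact: cfv].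
have dW z : is_derive z 1 (fun z => expR (- expR (- z)) + Fv z) (weight 0 z + fv z).
  exact: (is_deriveD (is_derive_profile0 z) (dFv z)).
rewrite (window_FTC n cw dW).
rewrite lee_fin /Fv.
have k0 : 0 <= expR 1 / (1 - b) by rewrite divr_ge0 ?expR_ge0// ltW.
have e1 z : 0 <= z -> 0 <= expR (- z) <= 1.
  by move=> z0; rewrite expR_ge0 expR_le1 oppr_le0.
move: (e1 _ (expR_ge0 (- n.+1%:R))) (e1 _ (expR_ge0 (- - n.+1%:R)))
  (e1 _ (expR_ge0 (- (1 - b) * n.+1%:R))) (e1 _ (expR_ge0 (- (1 - b) * - n.+1%:R))).
rewrite /v; nra.
Qed.

Lemma integral_tilted0 b : b < 1 -> 0 < b ->
  (\int[leb]_z (tilted b 0 z)%:E = (tilted_mass b)%:E)%E.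
Proof.
move=> b1 b0; rewrite fineK// ge0_fin_numE; last first.
  by apply: integral_ge0 => z _; rewrite lee_fin tilted_ge0.
apply: le_lt_trans (ltry (1 + expR 1 / (1 - b))).
have /cvg_lim <- // : (\int[leb]_(z in window n) (tilted b 0 z)%:E)%E @[n --> \oo]
   --> (\int[leb]_z (tilted b 0 z)%:E)%E.
  by apply: window_cvg => [|z]; [exact: measurable_Etilted|rewrite lee_fin tilted_ge0].
apply: lime_le; last by apply: nearW => n; exact: tilted_window_bounded.
apply/cvg_ex; eexists; apply: window_cvg => [|z]; first exact: measurable_Etilted.
by rewrite lee_fin tilted_ge0.
Qed.

Lemma tilted_window_fin b i n :
  (\int[leb]_(z in window n) (tilted b i z)%:E)%E \is a fin_num.
Proof.
apply: integrable_fin_num; first exact: measurable_itv.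
apply: continuous_compact_integrable; first exact: segment_compact.
by apply: continuous_subspaceT; exact: continuous_tilted.
Qed.

Lemma tilted_boundary b : b < 1 -> 0 < b ->
  (tilted b 0 n.+1%:R - tilted b 0 (- n.+1%:R)) @[n --> \oo] --> (0 : R).
Proof.
move=> b1 b0.
have geo k : 0 < k -> expR (- k) ^+ n.+1 @[n --> \oo] --> (0 : R).
  move=> k0; rewrite (cvg_shiftS (fun n => expR (- k) ^+ n)).
  by apply: cvg_expr; rewrite ger0_norm ?expR_ge0// expR_lt1 oppr_lt0.
have bound n : `|tilted b 0 n.+1%:R - tilted b 0 (- n.+1%:R)| <=
    expR (- (1 - b)) ^+ n.+1 + 4 * expR (- 1) ^+ n.+1.
  apply: (le_trans (ler_normB _ _)).
  rewrite !ger0_norm ?tilted_ge0// -!expRM_natl; apply: lerD.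
    rewrite /tilted /weight expr1 mulrA -expRD -[leRHS]mulr1 ler_pM ?expR_ge0//.
    by rewrite ler_expR; lra.
  rewrite /tilted /weight expr1 opprK mulrN1.
  have : expR (b * - n.+1%:R) <= 1.
    by rewrite expR_le1 mulrN oppr_le0 mulr_ge0// ltW.
  have : expR (n.+1%:R : R) * expR (- expR (n.+1%:R)) <= 4 * expR (- n.+1%:R).
    rewrite !expRN; set u := expR n.+1%:R.
    have u0 : 0 < u by exact: expR_gt0.
    have : (u / 2) ^+ 2 <= expR u.
      rewrite (_ : expR u = expR (u / 2) ^+ 2); last first.
        by rewrite -expRM_natl; congr expR; field.
      apply: lerXn2r; rewrite ?nnegrE ?expR_ge0 ?divr_ge0//; first exact: ltW.
      have : 1 + u / 2 <= expR (u / 2) by apply: expR_ge1Dx; lra.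
      lra.
    rewrite ler_pdivrMr ?expR_gt0// -mulrA -ler_pdivrMl// ler_pdivlMl// => h.
    by apply: le_trans h; rewrite expr2; lra.
  move=> h1 h2; apply: le_trans h1.
  by rewrite ler_piMl// mulr_ge0 ?expR_ge0.
pose h n := expR (- (1 - b)) ^+ n.+1 + 4 * expR (- 1) ^+ n.+1.
have h0 : h n @[n --> \oo] --> (0 : R).
  rewrite -[X in _ --> X](addr0 0) -[X in _ --> _ + X](mulr0 4).
  apply: cvgD; first by apply: geo; lra.
  by apply: cvgM; [exact: cvg_cst|exact: geo].
apply: (squeeze_cvgr (f := fun n => - h n) (h := h)) => //.
  by apply: nearW => n; rewrite -ler_norml; exact: bound.
by rewrite -[X in _ --> X]oppr0; exact: cvgN.
Qed.

(** [Gamma(2 - b) = (1 - b) Gamma(1 - b)], as a limit over bounded windows,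
    where the difference of the two sides is a boundary term. *)
Lemma integral_tilted1 b : b < 1 -> 0 < b ->
  (\int[leb]_z (tilted b 1 z)%:E = ((1 - b) * tilted_mass b)%:E)%E.
Proof.
move=> b1 b0.
pose a i n := fine (\int[leb]_(z in window n) (tilted b i z)%:E)%E.
have aE i n : (\int[leb]_(z in window n) (tilted b i z)%:E = (a i n)%:E)%E.
  by rewrite fineK// tilted_window_fin.
have cvgE i : (\int[leb]_(z in window n) (tilted b i z)%:E)%E @[n --> \oo]
    --> (\int[leb]_z (tilted b i z)%:E)%E.
  by apply: window_cvg => [|z]; [exact: measurable_Etilted|rewrite lee_fin tilted_ge0].
have parts n : a 1%N n = (1 - b) * a 0%N n +
    (tilted b 0 n.+1%:R - tilted b 0 (- n.+1%:R)).
  have cd : continuous (fun z => tilted b 1 z - (1 - b) * tilted b 0 z).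
    move=> z; apply: (@continuousB _ _ _ _ (fun z => (1 - b) * tilted b 0 z)).
      exact: continuous_tilted.
    by apply: continuousM; [exact: cst_continuous|exact: continuous_tilted].
  have int i : leb.-integrable (window n) (fun z => (tilted b i z)%:E).
    apply: continuous_compact_integrable; first exact: segment_compact.
    by apply: continuous_subspaceT; exact: continuous_tilted.
  have mw : measurable (window n) by exact: measurable_itv.
  have int' : leb.-integrable (window n) (fun z => (1 - b)%:E * (tilted b 0 z)%:E)%E.
    exact: integrableZl.
  have := window_FTC n cd (is_derive_tilted b).
  under eq_integral do rewrite EFinB (EFinM (1 - b)).
  rewrite integralB// integralZl//.
  rewrite !aE -EFinM -EFinB => -[<-]; lra.
have a0 : (a 0%N n) @[n --> \oo] --> tilted_mass b.
  apply: fine_cvg; rewrite -integral_tilted0//; exact: cvgE.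
have e : (fun n => \int[leb]_(z in window n) (tilted b 1 z)%:E)%E = EFin \o a 1%N.
  by apply/funext => n /=; rewrite aE.
have c1 := cvgE 1%N; rewrite e in c1.
apply: (cvg_unique _ c1) => //.
apply: cvg_EFin; first exact: nearW.
rewrite (_ : _ \o _ = a 1%N)//.
rewrite (_ : a 1%N = fun n => (1 - b) * a 0%N n +
    (tilted b 0 n.+1%:R - tilted b 0 (- n.+1%:R))); last exact/funext.
rewrite -[X in _ --> X]addr0; apply: cvgD; last exact: tilted_boundary.
by apply: cvgM => //; exact: cvg_cst.
Qed.

Lemma tilted_mass_gt0 b : b < 1 -> 0 < b -> 0 < tilted_mass b.
Proof.
move=> b1 b0; apply: (@lt_le_trans _ _ (expR (- 1) * expR (- 1))).
  by rewrite mulr_gt0 ?expR_gt0.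
rewrite -lee_fin -integral_tilted0//.
apply: (@le_trans _ _ (\int[leb]_(z in `[0%R, 1%R]) (expR (- 1) * expR (- 1))%:E)%E).
  rewrite integral_cst//= [X in (_ * X)%E]lebesgue_measure_itv/= lte_fin ltr01.
  by rewrite -EFinD subr0 mule1.
apply: (@le_trans _ _ (\int[leb]_(z in `[0%R, 1%R]) (tilted b 0 z)%:E)%E).
  apply: ge0_le_integral => //.
  - exact: measurable_Etilted.
  - move=> z /=; rewrite in_itv/= => /andP[z0 z1].
    rewrite lee_fin /tilted /weight expr1 -[leLHS]mul1r.
    apply: ler_pM => //.
      by rewrite -expR0 ler_expR mulr_ge0// ltW.
    apply: ler_pM; rewrite ?expR_ge0// ler_expR lerN2//.
    by rewrite expR_le1 oppr_le0.
apply: ge0_subset_integral => //; first exact: measurable_Etilted.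
by move=> z _; rewrite lee_fin tilted_ge0.
Qed.

End TiltedMass.

(** * Means of the statistics under a power law *)

Section Means.
Context (R : realType) (S : countType) (mu : probability {fset S} R).
Context (alpha c K : R).
Hypotheses (halpha : 0 < alpha < 1) (hc : 0 < c) (hK : 0 < K).
Hypothesis nu_tail : forall x : R, 0 < x < 1 ->
  (`| nu mu x - (c * x `^ (- alpha))%:E | <= (K * x `^ (- (alpha / 2)))%:E)%E.
Notation leb := (@lebesgue_measure R).
Notation M := (incidence mu).

Lemma nuE (x : R) : (nu mu x = \esum_(s in [set: S]) ((x < M s)%R%:R)%:E)%E.
Proof.
apply: eq_esum => s _; congr (nat_of_bool _)%:R%:E.
by rewrite /incidence_prob -measure_atoms [X in (_ < X)%E]massE lte_fin.
Qed.

Lemma incidence_le1 s : M s <= 1.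
Proof.
rewrite -lee_fin -massE -(probability_setT mu).
by apply: le_measure; rewrite ?inE.
Qed.

(** The hypothesis on [nu] extends to all [x > 0] once [K] is replaced by
    [K + c]: for [x >= 1], [nu mu x] vanishes and
    [x^(-alpha) <= x^(-alpha/2)].  Integrals over the whole half-line can thus be
    used without cutting off a tail. *)
Lemma nu_bounds (x : R) : 0 < x ->
  (nu mu x <= (c * x `^ (- alpha) + (K + c) * x `^ (- (alpha / 2)))%:E)%E /\
  ((c * x `^ (- alpha))%:E <= nu mu x + ((K + c) * x `^ (- (alpha / 2)))%:E)%E.
Proof.
move=> x0; have [a0 a1] := andP halpha.
have p0 : 0 <= x `^ (- alpha) by exact: powR_ge0.
have q0 : 0 <= x `^ (- (alpha / 2)) by exact: powR_ge0.
have [x1|x1] := ltP x 1; last first.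
  have -> : nu mu x = 0%E.
    rewrite nuE esum1// => s _.
    by rewrite ltNge (le_trans (incidence_le1 s) x1).
  have pq : x `^ (- alpha) <= x `^ (- (alpha / 2)).
    by apply: ler_powR => //; lra.
  have cpq : c * x `^ (- alpha) <= c * x `^ (- (alpha / 2)) by rewrite ler_wpM2l// ltW.
  have Kq : 0 <= K * x `^ (- (alpha / 2)) by rewrite mulr_ge0// ltW.
  have cp : 0 <= c * x `^ (- alpha) by rewrite mulr_ge0// ltW.
  by rewrite add0e !lee_fin mulrDl; split; lra.
have /nu_tail : 0 < x < 1 by rewrite x0.
have : (0 <= nu mu x)%E by rewrite nuE; apply: esum_ge0 => s _; rewrite lee_fin.
case: (nu mu x) => [v| |]//= _.
rewrite lee_fin ler_norml => /andP[l r].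
have cq : 0 <= c * x `^ (- (alpha / 2)) by rewrite mulr_ge0// ltW.
by rewrite -EFinD !lee_fin mulrDl; split; lra.
Qed.

Definition profile_mass i (b : R) : R :=
  (if i is 0%N then 1 else 1 - b) * tilted_mass b.

Lemma integral_tilted i (b : R) : (i <= 1)%N -> 0 < b < 1 ->
  (\int[leb]_z (tilted b i z)%:E = (profile_mass i b)%:E)%E.
Proof.
case: i => [|[|//]] _ /andP[b0 b1]; rewrite /profile_mass ?mul1r.
  exact: integral_tilted0.
exact: integral_tilted1.
Qed.

Lemma profile_ge0 i (y : R) : (i <= 1)%N -> 0 <= y -> 0 <= @profile R i y.
Proof.
move=> i1 y0; rewrite -lee_fin -layer_cake//; apply: integral_ge0 => z _.
by rewrite lee_fin mulr_ge0 ?weight_ge0.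
Qed.

Lemma powR_scale (tau z b : R) : 0 < tau ->
  (expR (- z) / tau) `^ (- b) = tau `^ b * expR (b * z).
Proof.
move=> t0; rewrite /powR gt_eqF ?divr_gt0 ?expR_gt0// gt_eqF//.
rewrite lnM ?posrE ?expR_gt0 ?invr_gt0// lnV ?posrE// expRK -expRD.
by congr expR; ring.
Qed.

Lemma measurable_threshold (y : R) :
  measurable_fun [set: R] (fun z => (expR (- z) < y)%R%:R : R).
Proof.
rewrite (_ : (fun z => _) = \1_[set z | expR (- z) < y]); last first.
  apply/funext => z; rewrite indicE; congr (nat_of_bool _)%:R.
  by apply/idP/idP; rewrite inE.
apply: measurable_indic; rewrite -[X in measurable X]setTI.
under eq_set do rewrite -lte_fin.
apply: measurable_lte => //; apply/measurable_EFinP => //.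
apply: continuous_measurable_fun.
by apply: is_derive_continuous => x; exact: is_derive_uN.
Qed.

(** Tonelli turns the sum over the species into the integral of
    [nu mu (e^-z / tau)] against [weight i].  The bounds on [nu] are kept in
    additive form, because subtraction of possibly infinite integrals would need
    integrability. *)
Lemma profile_sum i (tau : R) : (i <= 1)%N -> 0 < tau -> exists e,
  (\esum_(s in [set: S]) (profile i (tau * M s))%:E = e%:E)%E /\
  `|e - c * tau `^ alpha * profile_mass i alpha| <=
     (K + c) * tau `^ (alpha / 2) * profile_mass i (alpha / 2).
Proof.
move=> i1 t0; have [a0 a1] := andP halpha.
have tM0 s : 0 <= tau * M s by rewrite mulr_ge0 ?mass_ge0// ltW.
pose E := (\esum_(s in [set: S]) (profile i (tau * M s))%:E)%E.
pose g z := (\esum_(s in [set: S]) (weight i z * (expR (- z) < tau * M s)%R%:R)%:E)%E.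
have mg : measurable_fun setT g.
  apply: measurable_esum => // [s|s z]; last by rewrite lee_fin mulr_ge0 ?weight_ge0.
  apply/measurable_EFinP/measurable_funM; first exact: measurable_weight.
  exact: measurable_threshold.
have g0 z : (0 <= g z)%E.
  by apply: esum_ge0 => s _; rewrite lee_fin mulr_ge0 ?weight_ge0.
have EE : E = (\int[leb]_z g z)%E.
  rewrite integral_esum//; last 2 first.
  - move=> s; apply/measurable_EFinP/measurable_funM; first exact: measurable_weight.
    exact: measurable_threshold.
  - by move=> s z _; rewrite lee_fin mulr_ge0 ?weight_ge0.
  by apply: eq_esum => s _; rewrite layer_cake.
have gnu z : g z = ((weight i z)%:E * nu mu (expR (- z) / tau))%E.
  rewrite nuE -esumZl ?weight_ge0//; apply: eq_esum => s _.
  by rewrite ltr_pdivrMr// [tau * _]mulrC -EFinM.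
pose A := c * tau `^ alpha; pose D := (K + c) * tau `^ (alpha / 2).
have A0 : 0 <= A by rewrite mulr_ge0 ?powR_ge0// ltW.
have D0 : 0 <= D by rewrite mulr_ge0 ?powR_ge0// addr_ge0 ?ltW.
have I (b k : R) : 0 < b < 1 -> 0 <= k ->
    (\int[leb]_z (k%:E * (tilted b i z)%:E) = (k * profile_mass i b)%:E)%E.
  move=> b01 k0; rewrite ge0_integralZl_EFin//.
  - by rewrite integral_tilted.
  - by move=> z _; rewrite lee_fin tilted_ge0.
  - exact: measurable_Etilted.
have mk (b k : R) : measurable_fun setT (fun z => (k%:E * (tilted b i z)%:E)%E).
  by apply: measurable_funeM; exact: measurable_Etilted.
have k0 (b k : R) z : 0 <= k -> (0 <= k%:E * (tilted b i z)%:E)%E.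
  by move=> ?; rewrite mule_ge0 ?lee_fin ?tilted_ge0.
have h2 : 0 < alpha / 2 < 1 by apply/andP; split; lra.
have x0 z : 0 < expR (- z) / tau by rewrite divr_gt0 ?expR_gt0.
have upper : (E <= (A * profile_mass i alpha + D * profile_mass i (alpha / 2))%:E)%E.
  rewrite EE EFinD -!I//.
  rewrite -(ge0_integralD leb measurableT (fun z _ => k0 _ _ z A0) (mk _ _)
    (fun z _ => k0 _ _ z D0) (mk _ _)).
  apply: (ge0_le_integral leb measurableT (fun z _ => g0 z) mg) => //.
  - by apply: emeasurable_funD; [exact: mk|exact: mk].
  - move=> z _; rewrite gnu; have [+ _] := nu_bounds (x0 z).
    rewrite !powR_scale// => /(lee_wpmul2l _) -/(_ (weight i z)%:E).
    rewrite lee_fin weight_ge0 => /(_ isT) /le_trans -> //.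
    rewrite -!EFinM -EFinD lee_fin /tilted /A /D.
    by rewrite le_eqVlt; apply/orP; left; apply/eqP; ring.
have lower : ((A * profile_mass i alpha)%:E <=
    E + (D * profile_mass i (alpha / 2))%:E)%E.
  rewrite EE -!I//.
  rewrite -(ge0_integralD leb measurableT (fun z _ => g0 z) mg
    (fun z _ => k0 _ _ z D0) (mk _ _)).
  apply: (ge0_le_integral leb measurableT (fun z _ => k0 _ _ z A0) (mk _ _)) => //.
  - by apply: emeasurable_funD; [exact: mg|exact: mk].
  - move=> z _; rewrite gnu; have [_ +] := nu_bounds (x0 z).
    rewrite !powR_scale// => /(lee_wpmul2l _) -/(_ (weight i z)%:E).
    rewrite lee_fin weight_ge0 => /(_ isT) h.
    apply: (@le_trans _ _
        ((weight i z)%:E * (c * (tau `^ alpha * expR (alpha * z)))%:E)%E).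
      rewrite -!EFinM lee_fin /tilted /A.
      by rewrite le_eqVlt; apply/orP; left; apply/eqP; ring.
    apply: (le_trans h); rewrite ge0_muleDr; last 2 first.
    - by rewrite nuE; apply: esum_ge0 => s _; rewrite lee_fin.
    - by rewrite lee_fin !mulr_ge0 ?powR_ge0 ?expR_ge0 ?addr_ge0 ?ltW.
    rewrite leeD2l// -!EFinM lee_fin /tilted /D.
    by rewrite le_eqVlt; apply/orP; left; apply/eqP; ring.
have E0 : (0 <= E)%E by apply: esum_ge0 => s _; rewrite lee_fin profile_ge0.
move: upper lower E0; rewrite -/E; case: E {EE} => [e| |]//.
rewrite -EFinD !lee_fin => u l _; exists e; split=> //.
by rewrite ler_norml; apply/andP; split; rewrite -/A -/D; lra.
Qed.

(** The mean number of singletons is obtained as the mean number of species seen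
    at least once minus that of species seen at least twice. *)
Lemma mean_asymptotics (tau : R) : 0 < tau -> exists f g,
  [/\ (\esum_(s in [set: S]) (1 - expR (- (tau * M s)))%:E = f%:E)%E,
      (\esum_(s in [set: S]) (tau * M s * expR (- (tau * M s)))%:E = g%:E)%E,
      `|f - c * tilted_mass alpha * tau `^ alpha| <=
         2 * (K + c) * tilted_mass (alpha / 2) * tau `^ (alpha / 2) &
      `|g - alpha * (c * tilted_mass alpha) * tau `^ alpha| <=
         2 * (K + c) * tilted_mass (alpha / 2) * tau `^ (alpha / 2)].
Proof.
move=> t0; have [a0 a1] := andP halpha.
have tM0 s : 0 <= tau * M s by rewrite mulr_ge0 ?mass_ge0// ltW.
have [f [fE fb]] := profile_sum (leq0n 1) t0.
have [h [hE hb]] := profile_sum (leqnn 1) t0.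
have fE' : (\esum_(s in [set: S]) (1 - expR (- (tau * M s)))%:E = f%:E)%E.
  by rewrite -fE; apply: eq_esum => s _; rewrite /profile mul1r.
have gE : (\esum_(s in [set: S]) (tau * M s * expR (- (tau * M s)))%:E = (f - h)%:E)%E.
  have : (\esum_(s in [set: S]) (tau * M s * expR (- (tau * M s)))%:E + h%:E = f%:E)%E.
    rewrite -hE -esumD; last 2 first.
    - by move=> s _; rewrite lee_fin mulr_ge0 ?expR_ge0.
    - by move=> s _; rewrite lee_fin profile_ge0.
    rewrite -fE'; apply: eq_esum => s _; rewrite -EFinD /profile; congr EFin; ring.
  case: (\esum_(s in _) _)%E => [x| |]//; rewrite -EFinD => -[<-].
  by rewrite addrK.
have m0 : 0 < tilted_mass (alpha / 2) by apply: tilted_mass_gt0; lra.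
have D0 : 0 <= (K + c) * tau `^ (alpha / 2) * tilted_mass (alpha / 2).
  by rewrite !mulr_ge0 ?powR_ge0 ?addr_ge0 ?ltW.
exists f, (f - h); split=> //.
  rewrite /profile_mass !mul1r in fb.
  rewrite (_ : c * _ * _ = c * tau `^ alpha * tilted_mass alpha); last by ring.
  by apply: (le_trans fb); lra.
move: fb hb; rewrite /profile_mass !mul1r !ler_norml => /andP[f1 f2] /andP[h1 h2].
by apply/andP; split; nra.
Qed.

End Means.

(** * From the statistics to the loss *)

Section LossBound.
Context (R : realType).
Implicit Types (alpha c L q a r t W x y z : R).

Lemma expR_sub1_le (th : R) : `|th| <= 2^-1 -> `|expR th - 1| <= 2 * `|th|.
Proof.
move=> h; have e1 := expR_ge1Dx th.
have [t0|t0] := leP 0 th.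
  rewrite (ger0_norm t0) in h *; rewrite ger0_norm; last by lra.
  have := expR_ge1Dx (- th); rewrite expRN => e2.
  have : (1 - th) * expR th <= 1.
    by rewrite -[leRHS](mulVf (lt0r_neq0 (expR_gt0 th))) ler_wpM2r ?expR_ge0.
  have := expR_gt0 th; nra.
rewrite ltr0_norm// in h *.
have : expR th <= 1 by rewrite expR_le1 ltW.
by move=> ?; rewrite ler0_norm; lra.
Qed.

(** Here [a] stands for [t^(alpha/2)] and [lr] for [ln (1 + r)], so that
    [expR (y / x * lr)] is [(1 + r)^(y/x)].  The hypotheses make [x] comparable to
    [c * a ^+ 2] and the exponent [th] of the relative error at most [1 / 2],
    where the exponential is Lipschitz. *)
Lemma plug_in_error alpha c L q a lr x y z : 0 < alpha < 1 -> 0 < c -> 0 < L ->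
  0 < q -> 0 < a -> 0 <= lr -> 2 * L * q <= c * a -> 8 * L * q * lr <= c * a ->
  `|x - c * a ^+ 2| <= L * q * a -> `|y - alpha * c * a ^+ 2| <= L * q * a ->
  `|z - c * expR (alpha * lr) * a ^+ 2| <= L * q * a * expR (alpha * lr) ->
  `|z - x * expR (y / x * lr)| <= L * q * a * expR (alpha * lr) * (2 + 16 * lr).
Proof.
move=> /andP[a0 a1] c0 L0 q0 ap lr0 h1 h2 hx hy hz.
set e := L * q in h1 h2 hx hy hz *.
have e0 : 0 < e by rewrite mulr_gt0.
have ea0 : 0 < e * a by rewrite mulr_gt0.
have ca0 : 0 < c * a by rewrite mulr_gt0.
have h1' : 2 * (e * a) <= c * a ^+ 2.
  have : (2 * L * q) * a <= c * a * a by rewrite ler_wpM2r// ltW.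
  by rewrite /e expr2; lra.
have [xl xu] : c * a ^+ 2 / 2 <= x /\ x <= 2 * (c * a ^+ 2).
  by move: hx; rewrite ler_norml => /andP[]; split; lra.
have x0 : 0 < x by apply: lt_le_trans xl; rewrite divr_gt0// mulr_gt0// exprn_gt0.
set W := expR (alpha * lr) in hz *.
have W0 : 0 < W by exact: expR_gt0.
pose th := (y / x - alpha) * lr.
have vE : expR (y / x * lr) = W * expR th.
  by rewrite /W -expRD; congr expR; rewrite /th; ring.
have hyx : `|y / x - alpha| <= 4 * e / (c * a).
  have -> : y / x - alpha = (y - alpha * x) / x by field; lra.
  rewrite normrM normfV (gtr0_norm x0) ler_pdivrMr//.
  have n2 : `|y - alpha * x| <= 2 * (e * a).
    have -> : y - alpha * x =
        (y - alpha * c * a ^+ 2) - alpha * (x - c * a ^+ 2) by ring.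
    apply: (le_trans (ler_normB _ _)); rewrite normrM (gtr0_norm a0).
    have : alpha * `|x - c * a ^+ 2| <= 1 * (e * a).
      by apply: ler_pM => //; exact: ltW.
    lra.
  apply: (le_trans n2).
  have -> : 2 * (e * a) = 4 * e / (c * a) * (c * a ^+ 2 / 2).
    by field; rewrite ?gt_eqF.
  by rewrite ler_wpM2l// divr_ge0 ?ltW// mulr_gt0.
have hth : `|th| <= 4 * e / (c * a) * lr.
  by rewrite normrM (ger0_norm lr0) ler_wpM2r.
have hth2 : `|th| <= 2^-1.
  apply: (le_trans hth); rewrite mulrAC ler_pdivrMr//.
  by move: h2; rewrite /e; lra.
have hexp := expR_sub1_le hth2.
rewrite vE.
have -> : z - x * (W * expR th) = (z - c * W * a ^+ 2)
   - (W * (x - c * a ^+ 2) + x * W * (expR th - 1)) by ring.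
apply: (le_trans (ler_normB _ _)).
have n1 : `|W * (x - c * a ^+ 2)| <= W * (e * a).
  by rewrite normrM (gtr0_norm W0) ler_wpM2l// ltW.
have n2 : `|x * W * (expR th - 1)| <= W * (16 * (e * a) * lr).
  rewrite normrM gtr0_norm ?mulr_gt0// mulrAC [X in _ <= X]mulrC ler_wpM2r ?(ltW W0)//.
  apply: (@le_trans _ _ (2 * (c * a ^+ 2) * (2 * (4 * e / (c * a) * lr)))).
    by apply: ler_pM => //; [exact: ltW|lra].
  rewrite le_eqVlt; apply/orP; left; apply/eqP; field.
  by rewrite ?gt_eqF.
have := ler_normD (W * (x - c * a ^+ 2)) (x * W * (expR th - 1)).
lra.
Qed.

Lemma ln_add1_le r0 r : 1 < r0 -> r0 <= r ->
  ln (1 + r) <= (1 + (ln r0)^-1) * ln r.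
Proof.
move=> r01 r0r; have l0 : 0 < ln r0 by exact: ln_gt0.
have r1 : 1 <= r by lra.
have lr : ln r0 <= ln r by rewrite ler_ln ?posrE//; lra.
apply: (@le_trans _ _ (1 + ln r)).
  have -> : 1 + ln r = ln (expR 1 * r) by rewrite lnM ?posrE ?expR_gt0 ?expRK//; lra.
  rewrite ler_ln ?posrE ?mulr_gt0 ?expR_gt0//; [|lra|lra].
  have := @expR_ge1Dx R 1; nra.
by rewrite mulrDl mul1r addrC lerD2l mulrC ler_pdivlMr// mul1r.
Qed.

Lemma powR_half_sqr t alpha : t `^ alpha = (t `^ (alpha / 2)) ^+ 2.
Proof. by rewrite -powR_mulrn ?powR_ge0// -powRrM divfK. Qed.

Definition loss_constant L r0 : R :=
  (2 * L * (2 / ln r0 + 16 * (1 + (ln r0)^-1))) ^+ 2.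

Lemma loss_bound alpha c L r0 (B : nat) t r x y z :
  0 < alpha < 1 -> 0 < c -> 0 < L -> 1 < r0 -> (1 <= B)%N -> 0 < t -> r0 <= r ->
  let q := Num.sqrt B%:R in let a := t `^ (alpha / 2) in
  2 * L * q <= c * a -> 8 * L * q * ln (1 + r) <= c * a ->
  `|x - c * t `^ alpha| <= L * q * a ->
  `|y - alpha * c * t `^ alpha| <= L * q * a ->
  `|z - c * ((1 + r) * t) `^ alpha| <= L * q * ((1 + r) * t) `^ (alpha / 2) ->
  normalized_loss alpha r t (z - x) (x * ((1 + r) `^ (y / x) - 1))
    <= loss_constant L r0 * B%:R * ln r ^+ 2 / t `^ alpha.
Proof.
move=> al c0 L0 r01 B1 t0 r0r q a h1 h2 hx hy hz; have [a0 a1] := andP al.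
have r1 : 1 < r by lra.
have ap : 0 < a by exact: powR_gt0.
have q2 : q ^+ 2 = B%:R by rewrite sqr_sqrtr.
have q0 : 0 < q by rewrite sqrtr_gt0 ltr0n.
have l0 : 0 < ln r0 by exact: ln_gt0.
have lr0 : 0 <= ln (1 + r) by apply: ln_ge0; lra.
have lr : ln r0 <= ln r by rewrite ler_ln ?posrE//; lra.
have pw b : (1 + r) `^ b = expR (b * ln (1 + r)).
  by rewrite /powR gt_eqF//; lra.
have pwM b : ((1 + r) * t) `^ b = expR (b * ln (1 + r)) * t `^ b.
  by rewrite powRM ?pw//; lra.
rewrite !pwM powR_half_sqr -/a in hx hy hz.
set W := expR (alpha * ln (1 + r)) in hz.
have hz' : `|z - c * W * a ^+ 2| <= L * q * a * W.
  rewrite -mulrA; apply: (le_trans hz).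
  have : expR (alpha / 2 * ln (1 + r)) <= W by rewrite ler_expR ler_wpM2r//; lra.
  have Lqa : 0 <= L * q * a by rewrite !mulr_ge0 ?ltW.
  by move=> ?; rewrite [_ * a]mulrC mulrA ler_wpM2l.
have err := plug_in_error al c0 L0 q0 ap lr0 h1 h2 hx hy hz'.
have W2 : W <= 2 * r `^ alpha.
  have <- : (1 + r) `^ alpha = W by exact: pw.
  apply: (@le_trans _ _ ((2 * r) `^ alpha)).
    by apply: ge0_ler_powR; rewrite ?nnegrE ?ltW//; lra.
  rewrite powRM//; last by lra.
  rewrite ler_wpM2r ?powR_ge0//.
  by rewrite -[leRHS]powRr1// ler_powR//; lra.
set k := 2 / ln r0 + 16 * (1 + (ln r0)^-1).
have k0 : 0 <= k by rewrite addr_ge0 ?mulr_ge0 ?addr_ge0 ?invr_ge0 ?ltW.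
have hk : 2 + 16 * ln (1 + r) <= k * ln r.
  have := ln_add1_le r01 r0r.
  have : 1 <= (ln r0)^-1 * ln r by rewrite mulrC ler_pdivlMr// mul1r.
  rewrite /k; lra.
have tot : `|(z - x) - x * ((1 + r) `^ (y / x) - 1)|
    <= 2 * L * k * (q * a * r `^ alpha * ln r).
  rewrite pw (_ : _ - _ = z - x * expR (y / x * ln (1 + r))); last by ring.
  apply: (le_trans err).
  apply: (@le_trans _ _ (L * q * a * (2 * r `^ alpha) * (k * ln r))).
    apply: ler_pM => //.
    - by rewrite !mulr_ge0 ?expR_ge0 ?ltW.
    - by rewrite addr_ge0 ?mulr_ge0.
    - by rewrite ler_wpM2l// !mulr_ge0 ?ltW.
  rewrite le_eqVlt; apply/orP; left; apply/eqP; ring.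
have ra : 0 < r `^ alpha by rewrite powR_gt0//; lra.
rewrite /normalized_loss.
have -> : (r * t) `^ (2 * alpha) = (r `^ alpha * a ^+ 2) ^+ 2.
  rewrite [2 * alpha]mulrC powRrM powR_mulrn ?powR_ge0//.
  by rewrite /a -powR_half_sqr powRM//; lra.
have rp : 0 < r `^ alpha * a ^+ 2 by rewrite mulr_gt0// exprn_gt0.
rewrite ler_pdivrMr ?exprn_gt0//.
apply: (@le_trans _ _ ((2 * L * k * (q * a * r `^ alpha * ln r)) ^+ 2)).
  by rewrite lerXn2r// nnegrE; exact: le_trans (normr_ge0 _) tot.
rewrite /loss_constant -/k -q2 (powR_half_sqr t) -/a.
rewrite le_eqVlt; apply/orP; left; apply/eqP; field.
by rewrite gt_eqF.
Qed.

End LossBound.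

(** * Measurability of the statistics *)

Section Measurability.
Context (R : realType) (S : countType) (mu : probability {fset S} R).
Context d (T : measurableType d) (P : probability T R).
Context (L : T -> nat) (X : nat -> T -> {fset S}) (tau : R).
Hypothesis sampleLX : poisson_sample mu P L X tau.

Lemma measurable_count (p : pred nat) k : ~~ p 0%N ->
  (forall s, measurable [set w | p (first_count (X ^~ w) (L w) s)]) ->
  measurable [set w | #|` fset_set [set s | p (first_count (X ^~ w) (L w) s)]| = k].
Proof.
move=> p0 mp.
pose Z w : \bar R := (\esum_(s in [set: S])
  (\1_[set w | p (first_count (X ^~ w) (L w) s)] w)%:E)%E.
have mZ : measurable_fun setT Z.
  apply: measurable_esum => // s.
  by apply/measurable_EFinP; exact: measurable_indic.
rewrite (_ : [set w | _] = setT `&` Z @^-1` [set (k%:R)%:E]); first exact: mZ.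
rewrite setTI; apply/seteqP; have ZE w : Z w =
    (#|` fset_set [set s | p (first_count (X ^~ w) (L w) s)]|%:R)%:E.
  rewrite -esum_indic; last exact: finite_first_count.
  by apply: eq_esum => s _; rewrite !indicE.
split=> w /=; rewrite ZE; first by move=> ->.
by move=> [/eqP]; rewrite eqr_nat => /eqP.
Qed.

Lemma measurable_species_first k :
  measurable [set w | species_first (X ^~ w) (L w) = k].
Proof.
apply: (measurable_count (p := fun j => 0 < j)%N) => // s.
exact: measurable_seen sampleLX _.
Qed.

Lemma measurable_singletons_first k :
  measurable [set w | singletons_first (X ^~ w) (L w) = k].
Proof.
under eq_set do rewrite singletons_firstE.
apply: (measurable_count (p := pred1 1%N)) => // s.
rewrite (_ : [set w | _] = once L X s); last by apply/seteqP; split=> w /= /eqP.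
exact: measurable_once sampleLX _.
Qed.

End Measurability.

(** The statistics are integer valued, so any condition on them is a countable
    union of level sets. *)
Lemma measurable_nat3 d (T : measurableType d) (Z1 Z2 Z3 : T -> nat)
    (Q : nat -> nat -> nat -> Prop) :
  (forall k, measurable [set w | Z1 w = k]) ->
  (forall k, measurable [set w | Z2 w = k]) ->
  (forall k, measurable [set w | Z3 w = k]) ->
  measurable [set w | Q (Z1 w) (Z2 w) (Z3 w)].
Proof.
move=> m1 m2 m3.
rewrite (_ : [set w | _] = \bigcup_i \bigcup_j \bigcup_(k in [set k | Q i j k])
   ([set w | Z1 w = i] `&` ([set w | Z2 w = j] `&` [set w | Z3 w = k]))).
  do 3 (apply: bigcup_measurable => ? _).
  by apply: measurableI => //; exact: measurableI.
apply/seteqP; split=> w /=.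
  by move=> q; exists (Z1 w) => //; exists (Z2 w) => //; exists (Z3 w).
by move=> [i _ [j _ [k q [-> [-> ->]]]]].
Qed.

(** * Asymptotic bound on the loss *)

Lemma limf_esup_le (R : realType) (f : R -> \bar R) (M : \bar R) :
  (\forall t \near +oo, (f t <= M)%E) -> (limf_esup f +oo%R <= M)%E.
Proof.
move=> near_le; rewrite /limf_esup.
apply: (@le_trans _ _ (ereal_sup (f @` [set t | (f t <= M)%E]))).
  by apply: ereal_inf_lbound; exists [set t | (f t <= M)%E].
by apply: ge_ereal_sup => _ [t ft <-].
Qed.

Lemma powR_half_pinfty (R : realType) (alpha A : R) : 0 < alpha ->
  \forall t \near +oo, A <= t `^ (alpha / 2).
Proof.
move=> a0; pose A' := Num.max A 1.
have A'1 : 1 <= A' by rewrite le_max lexx orbT.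
apply: filterS (nbhs_pinfty_ge (num_real (A' `^ (2 / alpha)))) => t tA.
apply: (@le_trans _ _ A'); first by rewrite le_max lexx.
have -> : A' = (A' `^ (2 / alpha)) `^ (alpha / 2).
  rewrite -powRrM (_ : 2 / alpha * (alpha / 2) = 1) ?powRr1//; first lra.
  by field; rewrite gt_eqF.
have : 0 <= A' `^ (2 / alpha) by exact: powR_ge0.
move=> ?; apply: ge0_ler_powR; rewrite ?nnegrE//; last by lra.
by rewrite divr_ge0// ltW.
Qed.

(** The variance bound at the scale [rho sqrt B tau^(alpha/2)]: [B] and [tau]
    cancel. *)
Lemma scaled_variance (R : realType) (B : nat) (f D rho tau alpha : R) : (1 <= B)%N ->
  1 <= tau -> 0 < rho -> f <= D * tau `^ alpha ->
  27 * B%:R * f / (rho * Num.sqrt B%:R * tau `^ (alpha / 2)) ^+ 2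
    <= 27 * D / rho ^+ 2.
Proof.
move=> B1 t1 r0 fD.
have B0 : 0 < B%:R :> R by rewrite ltr0n.
have t0 : 0 < tau `^ alpha by rewrite powR_gt0; lra.
rewrite !exprMn (sqr_sqrtr (ltW B0)) -powR_half_sqr.
rewrite ler_pdivrMr ?mulr_gt0 ?exprn_gt0//.
have -> : 27 * D / rho ^+ 2 * (rho ^+ 2 * B%:R * tau `^ alpha)
    = 27 * B%:R * (D * tau `^ alpha) by field; rewrite gt_eqF.
by rewrite ler_wpM2l// mulr_ge0// ltW.
Qed.

Theorem corollary32 (R : realType) (eps alpha c K r0 : R)
    (heps : 0 < eps) (halpha : 0 < alpha < 1) (hc : 0 < c) (hK : 0 < K)
    (hr0 : 1 < r0) :
  exists C : R,
    forall (S : countType) (mu : probability {fset S} R) (B : nat) (r : R -> R)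
      (d : R -> measure_display) (Omega : forall t, measurableType (d t))
      (P : forall t, probability (Omega t) R)
      (X : forall t, nat -> {RV (P t) >-> {fset S}})
      (n m : forall t, {RV (P t) >-> nat}),
    (1 <= B)%N ->
    card_bounded mu B ->
    (fun t => ln (r t)) =o_ (pinfty_nbhs R) (fun t => t `^ (alpha / 2)) ->
    (forall t, 0 < t -> r0 <= r t) ->
    (forall x, 0 < x < 1 ->
      (`| nu mu x - (c * x `^ (- alpha))%:E | <=
         (K * x `^ (- (alpha / 2)))%:E)%E) ->
    (forall t, 0 < t ->
      poissonized_expeditions mu t (r t * t) (X t) (n t) (m t)) ->
    (limf_esup (fun t : R => P t [set w |
        C * B%:R * (ln (r t)) ^+ 2 / t `^ alpha <
        normalized_loss alpha (r t) t
          (unseen R (X t ^~ w) (n t w) (m t w))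
          (unseen_estimator (X t ^~ w) (r t) (n t w))]%R)
      +oo%R < eps%:E)%E.
Proof.
have [a0 a1] := andP halpha.
pose c' := c * tilted_mass alpha.
pose K' := 2 * (K + c) * tilted_mass (alpha / 2).
have c'0 : 0 < c' by rewrite mulr_gt0// tilted_mass_gt0.
have K'0 : 0 < K' by rewrite !mulr_gt0 ?addr_gt0 ?tilted_mass_gt0//; lra.
pose rho := Num.sqrt (162 * (c' + K') / eps).
have rho2 : rho ^+ 2 = 162 * (c' + K') / eps.
  by rewrite sqr_sqrtr// divr_ge0 ?ltW// mulr_gt0// addr_gt0.
have rho0 : 0 < rho by rewrite sqrtr_gt0 divr_gt0// mulr_gt0// addr_gt0.
(* The deviation from the mean has scale [rho], the error of the mean [K']. *)
pose L := rho + K'.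
have L0 : 0 < L by rewrite addr_gt0.
exists (loss_constant L r0) => S mu B r d Omega P X n m B1 muB lno r0r nu_tail exped.
pose q : R := Num.sqrt B%:R.
have q1 : 1 <= q by rewrite -[X in X <= _]sqrtr1 ler_sqrt// ler1n.
have q0 : 0 < q by lra.
have lr0 : 0 < ln r0 by exact: ln_gt0.
pose kap := 1 + (ln r0)^-1.
have kap0 : 0 < kap by rewrite addr_gt0// invr_gt0.
(* Once [ln (r t) <= e * t^(alpha/2)], the hypothesis of [plug_in_error] on
   [lr] holds. *)
pose e := c' / (8 * L * q * kap).
have e0 : 0 < e by rewrite divr_gt0// !mulr_gt0.
apply: (@le_lt_trans _ _ (eps / 2)%:E); last by rewrite lte_fin; lra.
apply: limf_esup_le.
have /eqoP/(_ e e0) near_r := lno.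
near=> t.
have t1 : 1 <= t by near: t; exact: nbhs_pinfty_ge.
have t0 : 0 < t by lra.
have rt : r0 <= r t by exact: r0r.
have h1 : 2 * L * q / c' <= t `^ (alpha / 2) by near: t; exact: powR_half_pinfty.
have : `|ln (r t)| <= e * `|t `^ (alpha / 2)| by near: t.
rewrite (ger0_norm (powR_ge0 _ _)) ger0_norm; last by apply: ln_ge0; lra.
set a := t `^ (alpha / 2) in h1 * => h2.
have h1' : 2 * L * q <= c' * a by rewrite [c' * a]mulrC -ler_pdivrMr.
have h2' : 8 * L * q * ln (1 + r t) <= c' * a.
  apply: (@le_trans _ _ (8 * L * q * (kap * (e * a)))).
    have p8 : 0 <= 8 * L * q by rewrite ltW// !mulr_gt0.
    rewrite ler_wpM2l//; apply: (le_trans (ln_add1_le hr0 rt)).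
    rewrite ler_wpM2l ?(ltW kap0)//.
  rewrite le_eqVlt; apply/orP; left; apply/eqP; rewrite /e; field.
  by rewrite !gt_eqF.
have rt0 : 0 < r t * t by rewrite mulr_gt0//; lra.
pose tau := (1 + r t) * t.
have tauE : tau = t + r t * t by rewrite /tau mulrDl mul1r.
have tau1 : 1 <= tau by rewrite tauE; lra.
have tau0 : 0 < tau by lra.
have smp1 := first_sample (exped t t0).
have smp2 : poisson_sample mu (P t) (fun w => (n t w + m t w)%N) (X t) tau.
  by rewrite tauE; exact: total_sample (exped t t0) t0 rt0.
have [f [g [fE gE fb gb]]] := mean_asymptotics halpha hc hK nu_tail t0.
have [f' [_ [f'E _ f'b _]]] := mean_asymptotics halpha hc hK nu_tail tau0.
rewrite -/c' -/K' in fb gb f'b.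
have mean_le (x y : R) : 1 <= x -> `|y - c' * x `^ alpha| <= K' * x `^ (alpha / 2) ->
    y <= (c' + K') * x `^ alpha.
  move=> x1 /ler_normlP[_]; have : x `^ (alpha / 2) <= x `^ alpha.
    by apply: ler_powR => //; lra.
  rewrite -(ler_pM2l K'0); lra.
pose l1 := rho * q * a; pose l2 := rho * q * tau `^ (alpha / 2).
have ap : 0 < a by apply: powR_gt0.
have bp : 0 < tau `^ (alpha / 2) by apply: powR_gt0.
have l10 : 0 < l1 by rewrite !mulr_gt0.
have l20 : 0 < l2 by rewrite !mulr_gt0.
(* [rho] was chosen so that three deviations add up to at most [eps / 2]. *)
have tail : 27 * (c' + K') / rho ^+ 2 <= eps / 6.
  rewrite rho2 le_eqVlt; apply/orP; left; apply/eqP; field.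
  by rewrite !gt_eqF// addr_gt0.
have P1 : (P t [set w | (l1 <= `|(species_first (X t ^~ w) (n t w))%:R - f|)%R]
    <= (eps / 6)%:E)%E.
  apply: (le_trans (seen_concentration muB smp1 t0 fE l10)); rewrite lee_fin.
  by apply: le_trans tail; apply: scaled_variance => //; exact: mean_le.
have P2 : (P t [set w | (l1 <= `|(singletons_first (X t ^~ w) (n t w))%:R - g|)%R]
    <= (eps / 6)%:E)%E.
  apply: (le_trans (once_concentration muB smp1 t0 fE gE l10)); rewrite lee_fin.
  by apply: le_trans tail; apply: scaled_variance => //; exact: mean_le.
have P3 : (P t [set w | (l2 <= `|(species_first (X t ^~ w) (n t w + m t w))%:R - f'|)%R]
    <= (eps / 6)%:E)%E.
  apply: (le_trans (seen_concentration muB smp2 tau0 f'E l20)); rewrite lee_fin.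
  by apply: le_trans tail; apply: scaled_variance => //; exact: mean_le.
set A1 := (X in P t X) in P1; set A2 := (X in P t X) in P2.
set A3 := (X in P t X) in P3.
have m1 := measurable_species_first smp1.
have m2 := measurable_singletons_first smp1.
have m3 := measurable_species_first smp2.
have mA1 : measurable A1.
  exact: (measurable_nat3 (fun i _ _ => l1 <= `|i%:R - f|) m1 m2 m3).
have mA2 : measurable A2.
  exact: (measurable_nat3 (fun _ i _ => l1 <= `|i%:R - g|) m1 m2 m3).
have mA3 : measurable A3.
  exact: (measurable_nat3 (fun _ _ i => l2 <= `|i%:R - f'|) m1 m2 m3).
have totalE w : species_total (X t ^~ w) (n t w) (m t w) =
    species_first (X t ^~ w) (n t w + m t w).
  rewrite /species_total /species_first; congr (#|` fset_set _|).
  apply/seteqP; split=> s /=;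
    by rewrite /first_count /second_count -big_cat_nat//= leq_addr.
set bad := (X in P t X).
have mbad : measurable bad.
  rewrite /bad; under eq_set do rewrite /unseen totalE.
  exact: (measurable_nat3 (fun i j k =>
    loss_constant L r0 * B%:R * ln (r t) ^+ 2 / t `^ alpha <
    normalized_loss alpha (r t) t (k%:R - i%:R)
      (i%:R * ((1 + r t) `^ (j%:R / i%:R) - 1))) m1 m2 m3).
have sub : bad `<=` A1 `|` (A2 `|` A3).
  move=> w; apply: contraPP; rewrite /bad /A1 /A2 /A3 /= => /not_orP[+ /not_orP[]].
  move=> /negP; rewrite -ltNge => d1 /negP; rewrite -ltNge => d2.
  move=> /negP; rewrite -ltNge => d3.
  apply/negP; rewrite -leNgt /unseen totalE /unseen_estimator.
  have shift (x y z l b : R) : 0 < b -> `|x - y| < rho * q * b -> `|y - z| <= K' * b ->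
      `|x - z| <= L * q * b.
    move=> b0 xy yz; have -> : x - z = (x - y) + (y - z) by ring.
    apply: (le_trans (ler_normD _ _)).
    have : K' * b <= K' * q * b.
      by rewrite ler_wpM2r ?(ltW b0)// ler_peMr// ltW.
    rewrite /L !mulrDl; lra.
  apply: (loss_bound halpha c'0 L0 hr0 B1 t0 rt h1' h2').
  - exact: shift d1 fb.
  - exact: shift d2 gb.
  - exact: shift d3 f'b.
apply: (@le_trans _ _ (P t (A1 `|` (A2 `|` A3)))).
  by apply: le_measure; rewrite ?inE//; apply: measurableU => //; exact: measurableU.
apply: (le_trans (measureU2 _ _ _)) => //; first exact: measurableU.
apply: (@le_trans _ _ ((eps / 6)%:E + ((eps / 6)%:E + (eps / 6)%:E))%E).
  apply: leeD => //; apply: (le_trans (measureU2 _ _ _)) => //.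
  exact: leeD.
by rewrite -!EFinD lee_fin; lra.
Unshelve. all: by end_near. Qed.
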